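(* Let $K,P,Q,m,n$ be as in the context. Let $P_M$ be the set of major final $\pi$-roots of $P$, and for $\tau\in P_M$ put $\lambda_\tau^Q:=\deg_x(Q(\tau))$. Set $$I_M:=\sum_{\tau\in P_M}|D_\tau^{P}|\,\lambda_\tau^Q .$$ Then $I_M=I(P,Q)$, where $I(P,Q):=\deg_x(\operatorname{Res}_y(P,Q))$ is the $x$-degree of the resultant of $P$ and $Q$ as polynomials in $y$.
   Context: **Notation.** $K$ is an algebraically closed field of characteristic $0$, $\mathbb N=\{1,2,\dots\}$, $L=K[x,y]$, $L^{(l)}=K[x^{\pm 1/l},y]$ for $l\in\mathbb N$, and $[F,G]=\partial_xF\,\partial_yG-\partial_xG\,\partial_yF$. A direction is a pair $(\rho,\sigma)\in\mathbb Z^2$ of coprime integers. Put $v_{\rho,\sigma}(i/l,j)=\rho i/l+\sigma j$. For $0\neq F\in L^{(l)}$, $v_{\rho,\sigma}(F)$ is the maximum of $v_{\rho,\sigma}$ over the support of $F$, and $\ell_{\rho,\sigma}(F)$ is the sum of the terms of $F$ at which this maximum is attained. If $\rho>0$, $\mathrm{st}_{\rho,\sigma}(F)$ (resp. $\mathrm{en}_{\rho,\sigma}(F)$) is the point of the support of $\ell_{\rho,\sigma}(F)$ with smallest (resp. largest) second coordinate. $K((x^{-1/l}))$ is the field of formal Laurent series in $x^{-1/l}$, $\pi$ is a variable, and $\deg_x$ of an element of $K[\pi]((x^{-1/l}))$ is its largest exponent of $x$ with nonzero coefficient. $F(\tau)$ means that $y$ is replaced by $\tau$ in $F$. **The pair.**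 $m,n>1$ are coprime integers. A pair $(P_0,Q_0)$ in $L$ is a standard $(m,n)$-pair if $[P_0,Q_0]\in K^\times$, $\frac{v_{1,1}(P_0)}{v_{1,1}(Q_0)}=\frac{v_{1,0}(P_0)}{v_{1,0}(Q_0)}=\frac mn$, $v_{1,-1}(\mathrm{en}_{1,0}(P_0))<0$ and $v_{1,-1}(\mathrm{st}_{1,0}(P_0))<0$. It is a minimal pair if it is a counterexample to the two-dimensional Jacobian Conjecture over $K$ and $\gcd(v_{1,1}(P_0),v_{1,1}(Q_0))$ is minimal among all such counterexamples. We fix $(P_0,Q_0)$ which is a minimal pair and a standard $(m,n)$-pair such that, for some integers $0<a<b$, $\mathrm{en}_{1,0}(P_0)=m(a,b)$, $\mathrm{en}_{1,0}(Q_0)=n(a,b)$, $\ell_{1,1}(P_0)=x^{am}y^{bm}$ and $\ell_{1,1}(Q_0)=x^{an}y^{bn}$. Let $\psi$ be the automorphism of $L$ with $\psi(y)=y$, $\psi(x)=x+y$, and put $P=\psi(P_0)$, $Q=\psi(Q_0)$, so $\ell_{1,1}(P)=(x+y)^{ma}y^{mb}$, $\ell_{1,1}(Q)=(x+y)^{na}y^{nb}$, and $P,Q$ are monic in $y$. **$\pi$-roots.** For $F\in\{P,Q\}$, $\mathcal R(F)$ is the multiset of roots of $F$ as a polynomial in $y$ (with multiplicity); all roots lie in $K((x^{-1/l}))$ for a suitable $l$, fixed and large enough. For $\tau=\sum_{j>j_0}a_jx^j+\pi x^{j_0}\in K[\pi,x^{\pm1/l}]$, $D_\tau^F$ is the sub-multiset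 of those $\alpha\in\mathcal R(F)$ whose coefficients of $x^j$ equal $a_j$ for all $j>j_0$; then $\tau$ is called the $\pi$-approximation of $\alpha$ up to $x^{j_0}$. $\tau$ is a $\pi$-root of $F$, of order $j_0$, if $D_\tau^F\neq\emptyset$. Put $\lambda_\tau^F=\deg_x(F(\tau))$, $\lambda_\tau=\lambda_\tau^P$, and let $f_{F,\tau}(\pi)\in K[\pi]$ be the coefficient of $x^{\lambda^F_\tau}$ in $F(\tau)$. A $\pi$-root $\tau$ of $F$ is final if $f_{F,\tau}$ has no multiple roots and $\deg f_{F,\tau}>1$. A final $\pi$-root $\tau$ of $P$ is minor if $\lambda_\tau=0$ and major if $\lambda_\tau>0$. **Genericity.** After adding a suitable constant of $K$ to $P$, we assume: for every $\pi$-root $\tau$ of $P$ with $\lambda_\tau=0$, $f_{P,\tau}$ has no multiple roots and $f_{P,\tau},f_{Q,\tau}$ are coprime; moreover $(0,0)$ lies in the supports of both $P$ and $Q$. *)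

(* Defs.v *)
From HB Require Import structures.
From mathcomp Require Import all_boot all_order all_algebra.
From mathcomp Require Import zify ring.
From mathcomp Require Import boolp classical_sets functions cardinality fsbigop.

Set Implicit Arguments.
Unset Strict Implicit.
Unset Printing Implicit Defensive.

Import Order.TTheory GRing.Theory Num.Theory.

Local Open Scope ring_scope.
Local Open Scope classical_set_scope.

(** * Formal Laurent series in 1/t *)

(* [laurent R] is R((t^-1)).  Below, t stands for x^(1/l), so that the index
   i : int stands for the exponent i/l of x. *)
Record laurent (R : comNzRingType) := Laurent {
  lcoef : int -> R;
  lcoef_bounded : exists N : int, forall i, N < i -> lcoef i = 0 }.

HB.instance Definition _ (R : comNzRingType) := gen_eqMixin (laurent R).
HB.instance Definition _ (R : comNzRingType) := gen_choiceMixin (laurent R).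

Lemma laurentP (R : comNzRingType) (f g : laurent R) :
  lcoef f =1 lcoef g -> f = g.
Proof.
case: f g => [f fP] [g gP] /= /funext fg; move: gP; rewrite -{g}fg => gP.
by congr Laurent; exact: Prop_irrelevance.
Qed.

Section LaurentRing.
Variable R : comNzRingType.
Implicit Types f g h : laurent R.

Fact lmon_subproof (c : R) (i : int) :
  exists N : int, forall j, N < j -> (if j == i then c else 0) = 0.
Proof. by exists i => j /gt_eqF ->. Qed.

Definition lmon (c : R) (i : int) : laurent R := Laurent (lmon_subproof c i).

Fact lzero_subproof :
  exists N : int, forall j : int, N < j -> (fun=> 0 : R) j = 0.
Proof. by exists 0. Qed.

Definition lzero : laurent R := Laurent lzero_subproof.

Fact lopp_subproof f : exists N : int, forall j, N < j -> - lcoef f j = 0.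
Proof. by have [N fN] := lcoef_bounded f; exists N => j /fN ->; rewrite oppr0. Qed.

Definition lopp f : laurent R := Laurent (lopp_subproof f).

Fact ladd_subproof f g :
  exists N : int, forall j, N < j -> lcoef f j + lcoef g j = 0.
Proof.
have [[M fM] [N gN]] := (lcoef_bounded f, lcoef_bounded g).
exists (Num.max M N) => j; rewrite gt_max => /andP[/fM -> /gN ->].
exact: addr0.
Qed.

Definition ladd f g : laurent R := Laurent (ladd_subproof f g).

Fact laddA : associative ladd.
Proof. by move=> f g h; apply: laurentP => i /=; rewrite addrA. Qed.
Fact laddC : commutative ladd.
Proof. by move=> f g; apply: laurentP => i /=; rewrite addrC. Qed.
Fact ladd0 : left_id lzero ladd.
Proof. by move=> f; apply: laurentP => i /=; rewrite add0r. Qed.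
Fact laddN : left_inverse lzero lopp ladd.
Proof. by move=> f; apply: laurentP => i /=; rewrite addNr. Qed.

HB.instance Definition _ :=
  GRing.isZmodule.Build (laurent R) laddA laddC ladd0 laddN.

Definition lconv (f g : int -> R) (k : int) : R :=
  \sum_(i \in [set: int]) f i * g (k - i).

Lemma lconv_window (f g : int -> R) (M N k : int) (n : nat) :
    (forall i, M < i -> f i = 0) -> (forall i, N < i -> g i = 0) ->
    M + N - k < n%:Z ->
  lconv f g k = \sum_(s < n) f (M - s%:Z) * g (k - M + s%:Z).
Proof.
move=> fM gN lt_n.
have ur : uniq [seq M - s%:Z | s <- iota 0 n].
  by rewrite map_inj_uniq ?iota_uniq // => s t; lia.
have H := @bigfs R 0 +%R int _ predT (fun i => f i * g (k - i)) ur.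
rewrite /lconv -[X in \sum_(i \in X) _](_ : [set` predT] = _); last first.
  by apply/seteqP; split.
rewrite -H => [|i _ /negP i_r].
  rewrite big_map -{1}[n]subn0 big_mkord; apply: eq_bigr => s _.
  by congr (_ * g _); ring.
have [/fM -> | leiM] := ltP M i; first by rewrite mul0r.
have [/gN -> | leN] := ltP N (k - i); first by rewrite mulr0.
case: i_r; apply/mapP; exists (`|M - i|%N); last by lia.
by rewrite mem_iota; lia.
Qed.

Fact lmul_subproof f g :
  exists N : int, forall k, N < k -> lconv (lcoef f) (lcoef g) k = 0.
Proof.
have [[M fM] [N gN]] := (lcoef_bounded f, lcoef_bounded g).
exists (M + N) => k ltk.
by rewrite (@lconv_window _ _ M N k 0) ?big_ord0 //; lia.
Qed.

Definition lmul f g : laurent R := Laurent (lmul_subproof f g).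

Fact lmulC : commutative lmul.
Proof.
move=> f g; apply: laurentP => k /=; rewrite /lconv.
rewrite (reindex_fsbigT (fun i => k - i)) /=; last first.
  by exists (fun i => k - i) => i; ring.
by apply: eq_fsbigr => i _; rewrite mulrC; congr (_ * _); congr (lcoef _ _); ring.
Qed.

Fact lmulA : associative lmul.
Proof.
move=> f g h; apply: laurentP => k /=.
have [[F fF] [G gG] [H hH]] :=
  And3 (lcoef_bounded f) (lcoef_bounded g) (lcoef_bounded h).
set n := (absz (F + G + H - k)%R).+1.
rewrite (@lconv_window _ _ F (G + H) k n) //; first last.
- by rewrite /n; lia.
- move=> j ltj; rewrite (@lconv_window _ _ G H j 0) ?big_ord0 //; lia.
rewrite (@lconv_window _ _ (F + G) H k n) //; first last.
- by rewrite /n; lia.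
- move=> j ltj; rewrite (@lconv_window _ _ F G j 0) ?big_ord0 //; lia.
under [RHS]eq_bigr => s _.
  rewrite (@lconv_window _ _ F G _ n) //; last by have := ltn_ord s; rewrite /n; lia.
  rewrite big_distrl /=; over.
rewrite exchange_big /=; apply: eq_bigr => r _.
rewrite (@lconv_window _ _ (G + r%:Z) H _ n) //; first last.
- by rewrite /n; lia.
- by move=> j ltj; apply: gG; lia.
rewrite big_distrr /=; apply: eq_bigr => s _.
rewrite mulrA; congr (_ * lcoef g _ * lcoef h _); ring.
Qed.

Fact lmul1 : left_id (lmon 1 0) lmul.
Proof.
move=> f; apply: laurentP => k /=; rewrite /lconv.
rewrite (fsbigE [:: 0]) //=; last first.
  by move=> i _; rewrite inE => /negPf ->; rewrite mul0r.
by rewrite big_mkcond big_seq1 in_setT eqxx mul1r subr0.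
Qed.

Fact lmulDl : left_distributive lmul ladd.
Proof.
move=> f g h; apply: laurentP => k /=.
have [[F fF] [G gG] [H hH]] :=
  And3 (lcoef_bounded f) (lcoef_bounded g) (lcoef_bounded h).
set M := Num.max F G.
have fM i : M < i -> lcoef f i = 0 by rewrite gt_max => /andP[/fF].
have gM i : M < i -> lcoef g i = 0 by rewrite gt_max => /andP[_ /gG].
set n := (absz (M + H - k)%R).+1.
have ltn : M + H - k < n%:Z by rewrite /n; lia.
rewrite !(@lconv_window _ _ M H k n) // => [|i ltMi].
  by rewrite -big_split; apply: eq_bigr => s _; rewrite /= mulrDl.
by rewrite fM // gM // addr0.
Qed.

Fact lone_neq0 : lmon 1 0 != lzero.
Proof.
apply/eqP => /(congr1 (fun f => lcoef f 0)) /= /eqP.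
by rewrite oner_eq0.
Qed.

HB.instance Definition _ := GRing.Zmodule_isComNzRing.Build (laurent R)
  lmulA lmulC lmul1 lmulDl lone_neq0.

End LaurentRing.

(* The value at the zero series is irrelevant. *)
Definition ldeg (R : comNzRingType) (f : laurent R) : int :=
  xget 0 [set i | lcoef f i != 0 /\ forall j, i < j -> lcoef f j = 0].

(** * Polynomials in x and y *)

(* K[x,y] is {poly {poly K}}: the outer variable is y, the inner one is x. *)

(* Evaluation at x = u and y = v, with h applied to the constants. *)
Definition evalx (K S : comNzRingType) (h : K -> S) (u : S) (p : {poly K}) : S :=
  (map_poly h p).[u].

Definition evalxy (K S : comNzRingType) (h : K -> S) (u v : S)
    (F : {poly {poly K}}) : S :=
  (map_poly (evalx h u) F).[v].

Section Plane.
Variable K : fieldType.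
Implicit Types (F G : {poly {poly K}}) (rho sigma : int) (p : nat * nat).

Definition varx : {poly {poly K}} := 'X%:P.
Definition vary : {poly {poly K}} := 'X.

Definition mono (c : K) p : {poly {poly K}} := c%:P%:P * varx ^+ p.1 * vary ^+ p.2.

(* The endomorphism of K[x,y] with x |-> F and y |-> G. *)
Definition endo F G : {poly {poly K}} -> {poly {poly K}} :=
  evalxy (fun c : K => c%:P%:P) F G.

Definition psi : {poly {poly K}} -> {poly {poly K}} := endo (varx + vary) vary.

Definition dx F : {poly {poly K}} := map_poly (fun p : {poly K} => p^`()) F.
Definition dy F : {poly {poly K}} := F^`().

Definition jac F G : {poly {poly K}} := dx F * dy G - dx G * dy F.

Definition jac_unit F G : Prop := exists2 c : K, c != 0 & jac F G = c%:P%:P.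

Definition support F : seq (nat * nat) :=
  [seq p <- [seq (i, j) | j <- iota 0 (size F), i <- iota 0 (size F`_j)] |
    F`_p.2`_p.1 != 0].

Definition vpt rho sigma p : int := rho * p.1%:Z + sigma * p.2%:Z.

(* The value at F = 0 is irrelevant. *)
Definition v rho sigma F : int :=
  let s := [seq vpt rho sigma p | p <- support F] in
  \big[Num.max/head 0 s]_(z <- s) z.

Definition lead rho sigma F : {poly {poly K}} :=
  \sum_(p <- support F | vpt rho sigma p == v rho sigma F) mono F`_p.2`_p.1 p.

Definition lead_points rho sigma F : seq (nat * nat) :=
  sort (fun p q => p.2 <= q.2)%N (support (lead rho sigma F)).

Definition st rho sigma F : nat * nat := head (0, 0)%N (lead_points rho sigma F).
Definition en rho sigma F : nat * nat := last (0, 0)%N (lead_points rho sigma F).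

Definition jc_counterexample F G : Prop :=
  jac_unit F G /\ ~ bijective (endo F G).

Definition minimal_pair F G : Prop :=
  jc_counterexample F G /\
  forall F' G', jc_counterexample F' G' ->
    gcdz (v 1 1 F) (v 1 1 G) <= gcdz (v 1 1 F') (v 1 1 G').

Definition standard_pair (m n : nat) F G : Prop :=
  [/\ jac_unit F G,
      (v 1 1 F)%:~R / (v 1 1 G)%:~R = m%:R / n%:R :> rat,
      (v 1 0 F)%:~R / (v 1 0 G)%:~R = m%:R / n%:R :> rat,
      vpt 1 (-1) (en 1 0 F) < 0 &
      vpt 1 (-1) (st 1 0 F) < 0].

End Plane.

Arguments varx {K}.
Arguments vary {K}.

(** * Puiseux roots and pi-roots *)

Section PiRoots.
Variables (K : fieldType) (l : nat).
Implicit Types (F : {poly {poly K}}) (roots : seq (laurent K)).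

(* [roots] lists, with multiplicity, the roots in K((x^(-1/l))) of F seen as a
   polynomial in y, all of which are required to lie in that field. *)
Definition root_multiset F roots : Prop :=
  let to_series := evalx (fun c : K => lmon c 0) (lmon 1 l%:Z) in
  map_poly to_series F =
    to_series (lead_coef F) *: \prod_(alpha <- roots) ('X - alpha%:P).

(* (d, p) encodes \sum_(k) p`_k x^((d + 1 + k)/l) + pi x^(d/l), so that
   j0 = d/l and p is the polynomial of coefficients a_j with j > j0. *)
Definition pi_approx : Type := (int * {poly K})%type.
Implicit Types tau : pi_approx.

HB.instance Definition _ := Choice.on pi_approx.

Definition pi_series tau : laurent {poly K} :=
  \sum_(k < size tau.2) lmon (tau.2`_k)%:P (tau.1 + 1 + k%:Z) + lmon 'X tau.1.

(* F(tau), in K[pi]((x^(-1/l))). *)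
Definition subst_pi F tau : laurent {poly K} :=
  evalxy (fun c : K => lmon c%:P 0) (lmon 1 l%:Z) (pi_series tau) F.

Definition D roots tau : seq (laurent K) :=
  [seq alpha <- roots |
    `[< forall k : nat, lcoef alpha (tau.1 + 1 + k%:Z) = tau.2`_k >]].

Definition pi_root roots tau : Prop := D roots tau != [::].

Definition lambda F tau : rat := (ldeg (subst_pi F tau))%:~R / l%:R.

Definition f_ F tau : {poly K} :=
  lcoef (subst_pi F tau) (ldeg (subst_pi F tau)).

Definition no_multiple_roots (f : {poly K}) : Prop :=
  forall z : K, (mup z f <= 1)%N.

Definition final_pi_root F roots tau : Prop :=
  [/\ pi_root roots tau, no_multiple_roots (f_ F tau) &
      (1 < (size (f_ F tau)).-1)%N].

Definition major_pi_roots F roots : set pi_approx :=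
  [set tau | final_pi_root F roots tau /\ 0 < lambda F tau].

End PiRoots.

(* The first clause ranges over every l over which F splits, so that pi-roots
   of every rational order are covered: lambda may vanish at an order that is
   not in (1/l)Z for the smallest such l. *)
Definition generic (K : fieldType) (F G : {poly {poly K}}) : Prop :=
  [/\ forall (l : nat) (roots : seq (laurent K)) (tau : pi_approx K),
        (0 < l)%N -> root_multiset l F roots ->
        pi_root roots tau -> lambda l F tau = 0 ->
        no_multiple_roots (f_ l F tau) /\ coprimep (f_ l F tau) (f_ l G tau),
      (0, 0)%N \in support F & (0, 0)%N \in support G].

(* Main.v *)
Require Import Defs.
From HB Require Import structures.
From mathcomp Require Import all_boot all_order all_algebra.
From mathcomp Require Import perm zify ring.
From mathcomp Require Import boolp classical_sets fsbigop.

Set Implicit Arguments.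
Unset Strict Implicit.
Unset Printing Implicit Defensive.

Import Order.TTheory GRing.Theory Num.Theory.

Local Open Scope ring_scope.
Local Open Scope classical_set_scope.


(** Write [t = x^(1/l)].  Since [P] and [Q] are monic in [y], the resultant is the
    product of the values [Q(alpha)] over the roots [alpha] of [P], so its degree
    is the sum of the degrees of the [Q(alpha)].  It therefore suffices to attach
    to each root [alpha] of [P] one pi-approximation [tau] at which [P(tau)] has
    nonnegative degree and [Q(alpha)] has the same degree as [Q(tau)], in such a
    way that the [tau] of positive degree are exactly the major final pi-roots,
    each [tau] arising from the roots in its [D], and that the roots attached
    to degree zero contribute nothing.

    Factoring [P] as a product of [y - beta] makes everything about [P(tau)]
    explicit when [tau] is the pi-approximation of [alpha] of order [i]
    (lemma [subst_pi_lead]).  A root [beta] that agrees with [alpha] above [i]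
    contributes [i] to the degree and [pi - beta_i] to the leading polynomial; any
    other one contributes the degree of [alpha - beta] and a constant.  So
    lowering [i] by one lowers the degree of [P(tau)] by the number of roots that
    still agree with [alpha], and that number is the multiplicity of [alpha_i] as
    a root of the leading polynomial at [i].

    The Jacobian condition enters as a differential equation
    ([bracket_constant]): if [p], [q] are the leading exponents of [P(tau)],
    [Q(tau)] and [f], [g] the leading polynomials, then [p f g' - q g f'] is a
    constant.  If this constant is not zero, [f] is squarefree and prime to [g].
    If it is zero, then [p] times the multiplicity in [g] is [q] times the
    multiplicity in [f] at every point.

    The order [i] now descends along [alpha] ([splits_exists]).  For large [i]
    all roots agree, and both the degrees and the numbers of agreeing roots
    for [P] and [Q] are in the ratio [m : n].  While the constant is zero this
    proportionality is inherited by the next order.  It forces the number of agreeing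
    roots of [P] to be a positive multiple of [m], hence at least two, so the
    degree strictly decreases and the descent must stop.  It stops either with a
    nonzero constant at positive degree, or at degree zero, where the genericity
    assumption says that [f] is squarefree and prime to [g].  The degree cannot
    jump from positive to negative: it would vanish at a fractional order in
    between, where the leading polynomial is a power of [pi] with exponent at
    least two, contrary to genericity over a ramified extension of the series
    field ([no_fractional_zero]).

    Where the descent stops, [f] is squarefree of degree at least two, which
    happens at one order only along [alpha]; so the final pi-root through
    [alpha] is unique.  Coprimality of [f] and [g] says that no root of [Q] gets
    closer to [alpha] than [tau] does, so that [Q(alpha)] and [Q(tau)] have the
    same degree, which is [n/m] times the degree of [P(tau)] and in particular
    zero when the latter is. *)

(** * Laurent series: leading terms, morphisms and derivations *)

Section LaurentCoefficients.
Variable R : comNzRingType.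
Implicit Types f g : laurent R.

Lemma lcoefD f g i : lcoef (f + g) i = lcoef f i + lcoef g i.
Proof. by []. Qed.

Lemma lcoefB f g i : lcoef (f - g) i = lcoef f i - lcoef g i.
Proof. by []. Qed.

Lemma lcoef0 i : lcoef (0 : laurent R) i = 0.
Proof. by []. Qed.

Lemma lcoef_mon c i j : lcoef (lmon c i : laurent R) j = if j == i then c else 0.
Proof. by []. Qed.

Lemma lcoefM f g i : lcoef (f * g) i = lconv (lcoef f) (lcoef g) i.
Proof. by []. Qed.

Lemma lcoef_sum (I : Type) (r : seq I) (P : pred I) (F : I -> laurent R) i :
  lcoef (\sum_(k <- r | P k) F k) i = \sum_(k <- r | P k) lcoef (F k) i.
Proof. exact: (big_morph (fun f => lcoef f i) (fun f g => lcoefD f g i) (lcoef0 i)). Qed.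

(** The indices can be taken on a list adapted to the factors, for instance the
    multiples of [d] for series in [t^d]. *)
Lemma lconv_seq (f g : int -> R) (k : int) (s : seq int) :
    uniq s -> (forall i, i \notin s -> f i * g (k - i) = 0) ->
  lconv f g k = \sum_(i <- s) f i * g (k - i).
Proof.
move=> us fg0; rewrite /lconv -[X in \sum_(i \in X) _](_ : [set` predT] = _).
  by rewrite -(@bigfs _ _ _ _ s) // => i _; exact: fg0.
by apply/seteqP; split.
Qed.

Lemma lcoef_monM c i f k : lcoef (lmon c i * f) k = c * lcoef f (k - i).
Proof.
rewrite lcoefM (@lconv_seq _ _ _ [:: i]) //= ?big_seq1 ?eqxx // => j.
by rewrite inE => /negPf ->; rewrite mul0r.
Qed.

Lemma lmonM c d i j : lmon c i * lmon d j = lmon (c * d) (i + j) :> laurent R.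
Proof.
apply: laurentP => k; rewrite lcoef_monM !lcoef_mon.
have -> : (k - i == j) = (k == i + j) by lia.
by case: ifP; rewrite ?mulr0.
Qed.

(** The coefficient [c] may vanish, which makes this property stable under
    products over any ring; the lemmas that read off the degree ask for [c != 0]. *)
Definition has_lead f i c : Prop :=
  lcoef f i = c /\ forall j, i < j -> lcoef f j = 0.

Lemma has_leadM f g i j c d :
  has_lead f i c -> has_lead g j d -> has_lead (f * g) (i + j) (c * d).
Proof.
move=> [fi f0] [gj g0]; split=> [|k ltk]; rewrite lcoefM.
  rewrite (@lconv_window _ _ _ i j _ 1) //; last by lia.
  rewrite big_ord_recl big_ord0 /= addr0 -fi -gj; congr (lcoef f _ * lcoef g _); lia.
by rewrite (@lconv_window _ _ _ i j _ 0) ?big_ord0 //; lia.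
Qed.

Lemma has_lead_mon c i : has_lead (lmon c i : laurent R) i c.
Proof. by split=> [|j /gt_eqF ltj] /=; rewrite ?eqxx ?ltj. Qed.

Lemma has_lead1 : has_lead (1 : laurent R) 0 1.
Proof. exact: has_lead_mon. Qed.

Lemma has_lead_prod (I : eqType) (r : seq I) (F : I -> laurent R) e c :
    {in r, forall k, has_lead (F k) (e k) (c k)} ->
  has_lead (\prod_(k <- r) F k) (\sum_(k <- r) e k) (\prod_(k <- r) c k).
Proof.
elim: r => [|k r IHr] Fk; first by rewrite !big_nil; exact: has_lead1.
rewrite !big_cons; apply: has_leadM; first by apply: Fk; rewrite mem_head.
by apply: IHr => j jr; apply: Fk; rewrite inE jr orbT.
Qed.

Lemma has_lead_ldeg f i c : c != 0 -> has_lead f i c -> ldeg f = i.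
Proof.
move=> c0 [fi f0]; apply: xget_unique => [|j [fj f0j]]; first by split; rewrite ?fi.
have [/f0j fi0|/f0 fj0|//] := ltgtP j i.
  by move: c0; rewrite -fi fi0 eqxx.
by move: fj; rewrite fj0 eqxx.
Qed.

Lemma has_lead_uniq f i j c d :
  c != 0 -> d != 0 -> has_lead f i c -> has_lead f j d -> i = j /\ c = d.
Proof.
move=> c0 d0 hi hj.
have eij : i = j by rewrite -(has_lead_ldeg c0 hi) (has_lead_ldeg d0 hj).
by split=> //; case: hi hj => <- _ [<- _]; rewrite eij.
Qed.

Lemma exists_lead f : f != 0 -> exists i c, c != 0 /\ has_lead f i c.
Proof.
move=> f0; have [N fN] := lcoef_bounded f.
have [i fi] : exists i, lcoef f i != 0.
  apply: contrapT => /forallNP fE; case/eqP: f0; apply: laurentP => i.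
  by apply/eqP/negP => /negP; apply: fE.
have leiN : i <= N by rewrite leNgt; apply: contra fi => /fN ->.
pose p := fun k : nat => lcoef f (N - k%:Z) != 0.
have exk : exists k, p k.
  by exists (absz (N - i)%R); rewrite /p (_ : N - _ = i) //; lia.
case: (ex_minnP exk) => k pk mink.
exists (N - k%:Z), (lcoef f (N - k%:Z)); split=> //; split=> // j ltj.
have [/fN //|lejN] := ltP N j.
apply/eqP/negPn/negP => fj.
have /mink : p (absz (N - j)%R) by rewrite /p (_ : N - _ = j) //; lia.
by lia.
Qed.

End LaurentCoefficients.

Lemma laurent_integral (R : idomainType) (f g : laurent R) :
  f * g = 0 -> f = 0 \/ g = 0.
Proof.
move=> fg0; have [->|/exists_lead [i [c [c0 hf]]]] := eqVneq f 0; first by left.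
have [->|/exists_lead [j [d [d0 hg]]]] := eqVneq g 0; first by right.
have [/esym/eqP] := has_leadM hf hg.
by rewrite fg0 lcoef0 mulf_eq0 (negPf c0) (negPf d0).
Qed.

Section LaurentMorphisms.
Variables R S : comNzRingType.

Definition lconst (c : R) : laurent R := lmon c 0.

Fact lconst_zmod : zmod_morphism lconst.
Proof. by move=> c d; apply: laurentP => i /=; case: eqP; rewrite ?subr0. Qed.
Fact lconst_monoid : monoid_morphism lconst.
Proof. by split=> // c d; rewrite /lconst lmonM addr0. Qed.
HB.instance Definition _ := GRing.isZmodMorphism.Build _ _ lconst lconst_zmod.
HB.instance Definition _ := GRing.isMonoidMorphism.Build _ _ lconst lconst_monoid.

Variable h : {rmorphism R -> S}.

Fact lmap_subproof (f : laurent R) :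
  exists N : int, forall j, N < j -> h (lcoef f j) = 0.
Proof. by have [N fN] := lcoef_bounded f; exists N => j /fN ->; rewrite rmorph0. Qed.

Definition lmap (f : laurent R) : laurent S := Laurent (lmap_subproof f).

Fact lmap_zmod : zmod_morphism lmap.
Proof. by move=> f g; apply: laurentP => i; rewrite /= rmorphB. Qed.
Fact lmap_monoid : monoid_morphism lmap.
Proof.
split=> [|f g]; apply: laurentP => i.
  by rewrite /=; case: eqP; rewrite ?rmorph0 ?rmorph1.
have [[M fM] [N gN]] := (lcoef_bounded f, lcoef_bounded g).
have ltn : M + N - i < (absz (M + N - i)%R).+1%:Z by lia.
rewrite lcoefM (@lconv_window _ _ _ _ _ _ _ _ _ ltn); first last.
- by move=> j /gN /= ->; rewrite rmorph0.
- by move=> j /fM /= ->; rewrite rmorph0.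
rewrite /= (lconv_window fM gN ltn) rmorph_sum.
by apply: eq_bigr => s _; rewrite rmorphM.
Qed.
HB.instance Definition _ := GRing.isZmodMorphism.Build _ _ lmap lmap_zmod.
HB.instance Definition _ := GRing.isMonoidMorphism.Build _ _ lmap lmap_monoid.

Lemma lmap_mon c i : lmap (lmon c i) = lmon (h c) i.
Proof. by apply: laurentP => j /=; case: eqP; rewrite ?rmorph0. Qed.

End LaurentMorphisms.

Section Stretch.
Variables (R : comNzRingType) (d : nat).
Hypothesis d_gt0 : (0 < d)%N.
Implicit Types f g : laurent R.

Fact lstretch_subproof f : exists N : int, forall j, N < j ->
  (if (d %| j)%Z then lcoef f (j %/ d)%Z else 0) = 0.
Proof.
have [N fN] := lcoef_bounded f; exists (`|N| * d%:Z) => j ltj.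
by case: ifP => // /divzK dj; apply: fN; nia.
Qed.

(** The inclusion of K((x^(-1/l))) in K((x^(-1/(l d)))): the variable [t] of the
    source is the [d]-th power of that of the target. *)
Definition lstretch f : laurent R := Laurent (lstretch_subproof f).

Lemma lstretch_mul f i : lcoef (lstretch f) (i * d%:Z) = lcoef f i.
Proof. by rewrite /= dvdz_mull // mulzK //; lia. Qed.

Lemma lstretch_ndvd f i : ~~ (d %| i)%Z -> lcoef (lstretch f) i = 0.
Proof. by rewrite /= => /negPf ->. Qed.

Lemma lstretch_mon c i : lstretch (lmon c i) = lmon c (i * d%:Z).
Proof.
apply: laurentP => j; have [/divzK dj|Ndj] := boolP (d %| j)%Z.
  rewrite -dj lstretch_mul !lcoef_mon; congr (if _ then _ else _); nia.
rewrite lstretch_ndvd // lcoef_mon; case: eqP => // E.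
by rewrite E dvdz_mull in Ndj.
Qed.

Fact lstretch_zmod : zmod_morphism lstretch.
Proof. by move=> f g; apply: laurentP => i /=; case: ifP; rewrite ?subr0. Qed.

Fact lstretch_monoid : monoid_morphism lstretch.
Proof.
split=> [|f g]; first by rewrite -[RHS]/(lmon 1 0) -[1]/(lmon 1 0) lstretch_mon mul0r.
apply: laurentP => k.
have [[M fM] [N gN]] := (lcoef_bounded f, lcoef_bounded g).
have [/divzK dk|Ndk] := boolP (d %| k)%Z; last first.
  rewrite lstretch_ndvd // lcoefM (@lconv_seq _ _ _ _ [::]) ?big_nil // => i _.
  have [di|/lstretch_ndvd ->] := boolP (d %| i)%Z; last by rewrite mul0r.
  rewrite [lcoef _ (k - i)]lstretch_ndvd ?mulr0 //.
  by apply: contra Ndk => dki; rewrite -(subrK i k) rpredD.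
rewrite -dk lstretch_mul; set k0 := (k %/ d)%Z.
have us (s : seq int) : uniq s -> uniq [seq i * d%:Z | i <- s].
  by move=> ?; rewrite map_inj_uniq // => x y; nia.
pose s := [seq M - j%:Z | j <- iota 0 (absz (M + N - k0)%R).+1].
have ss : uniq s by rewrite map_inj_uniq ?iota_uniq // => x y; lia.
have out i : i \notin s -> lcoef f i * lcoef g (k0 - i) = 0.
  have [/fM -> _|leiM] := ltP M i; first by rewrite mul0r.
  have [/gN -> _|leN] := ltP N (k0 - i); first by rewrite mulr0.
  case/negP; apply/mapP; exists (absz (M - i)%R); last by lia.
  by rewrite mem_iota; lia.
rewrite !lcoefM (lconv_seq ss out) (lconv_seq (us _ ss)).
  rewrite [RHS]big_map; apply: eq_bigr => i _.
  by rewrite -mulrBl !lstretch_mul.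
move=> i; have [/divzK di|/lstretch_ndvd -> _] := boolP (d %| i)%Z; last by rewrite mul0r.
rewrite -di -mulrBl !lstretch_mul => i_s; apply: out.
by apply: contra i_s => /(map_f (fun i => i * d%:Z)).
Qed.

HB.instance Definition _ := GRing.isZmodMorphism.Build _ _ lstretch lstretch_zmod.
HB.instance Definition _ := GRing.isMonoidMorphism.Build _ _ lstretch lstretch_monoid.

End Stretch.

Section Derivations.

Definition derivation (S : comNzRingType) (d : S -> S) : Prop :=
  (forall f g, d (f + g) = d f + d g) /\ (forall f g, d (f * g) = d f * g + f * d g).

Lemma derivation0 (S : comNzRingType) (d : S -> S) : derivation d -> d 0 = 0.
Proof. by case=> dD _; apply: (addrI (d 0)); rewrite -dD !addr0. Qed.

Variable K : comNzRingType.

Fact ltheta_subproof (f : laurent K) :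
  exists N : int, forall j, N < j -> j%:~R * lcoef f j = 0.
Proof. by have [N fN] := lcoef_bounded f; exists N => j /fN ->; rewrite mulr0. Qed.

(** The Euler operator [t d/dt]. *)
Definition ltheta (f : laurent K) : laurent K := Laurent (ltheta_subproof f).

Lemma ltheta_derivation : derivation ltheta.
Proof.
split=> f g; apply: laurentP => i; first by rewrite /= mulrDr.
have [[M fM] [N gN]] := (lcoef_bounded f, lcoef_bounded g).
have ltn : M + N - i < (absz (M + N - i)%R).+1%:Z by lia.
have tM (e : laurent K) (L : int) : (forall j, L < j -> lcoef e j = 0) ->
    forall j, L < j -> lcoef (ltheta e) j = 0.
  by move=> eL j /eL /= ->; rewrite mulr0.
rewrite lcoefD [LHS]/= !lcoefM.
rewrite (lconv_window fM gN ltn) (lconv_window (tM _ _ fM) gN ltn).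
rewrite (lconv_window fM (tM _ _ gN) ltn) mulr_sumr -big_split.
apply: eq_bigr => s _ /=.
have {1}-> : i = (M - s%:Z) + (i - M + s%:Z) by ring.
by rewrite intrD; ring.
Qed.

Fact lderiv_subproof (f : laurent {poly K}) :
  exists N : int, forall j, N < j -> (lcoef f j)^`() = 0.
Proof. by have [N fN] := lcoef_bounded f; exists N => j /fN ->; rewrite linear0. Qed.

Definition lderiv (f : laurent {poly K}) : laurent {poly K} :=
  Laurent (lderiv_subproof f).

Lemma lderiv_derivation : derivation lderiv.
Proof.
split=> f g; apply: laurentP => i; first by rewrite /= derivD.
have [[M fM] [N gN]] := (lcoef_bounded f, lcoef_bounded g).
have ltn : M + N - i < (absz (M + N - i)%R).+1%:Z by lia.
have tM (e : laurent {poly K}) (L : int) : (forall j, L < j -> lcoef e j = 0) ->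
    forall j, L < j -> lcoef (lderiv e) j = 0.
  by move=> eL j /eL /= ->; rewrite linear0.
rewrite lcoefD [LHS]/= !lcoefM.
rewrite (lconv_window fM gN ltn) (lconv_window (tM _ _ fM) gN ltn).
rewrite (lconv_window fM (tM _ _ gN) ltn) linear_sum -big_split.
by apply: eq_bigr => s _ /=; rewrite derivM.
Qed.

End Derivations.

(** * Evaluation, the chain rule and the Jacobian *)

Section Evaluation.
Variables (K S : comNzRingType) (h : {rmorphism K -> S}) (u v : S).

Fact evalx_zmod : zmod_morphism (evalx h u).
Proof. by move=> p q; rewrite /evalx rmorphB hornerD hornerN. Qed.
Fact evalx_monoid : monoid_morphism (evalx h u).
Proof.
by split=> [|p q]; rewrite /evalx ?rmorph1 ?hornerE // rmorphM hornerM.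
Qed.
HB.instance Definition _ := GRing.isZmodMorphism.Build _ _ (evalx h u) evalx_zmod.
HB.instance Definition _ := GRing.isMonoidMorphism.Build _ _ (evalx h u) evalx_monoid.

Lemma evalxX : evalx h u 'X = u.
Proof. by rewrite /evalx map_polyX hornerX. Qed.

Lemma evalxC c : evalx h u c%:P = h c.
Proof. by rewrite /evalx map_polyC hornerC. Qed.

Fact evalxy_zmod : zmod_morphism (evalxy h u v).
Proof. by move=> F G; rewrite /evalxy rmorphB hornerD hornerN. Qed.
Fact evalxy_monoid : monoid_morphism (evalxy h u v).
Proof.
by split=> [|F G]; rewrite /evalxy ?rmorph1 ?hornerE // rmorphM hornerM.
Qed.
HB.instance Definition _ := GRing.isZmodMorphism.Build _ _ (evalxy h u v) evalxy_zmod.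
HB.instance Definition _ :=
  GRing.isMonoidMorphism.Build _ _ (evalxy h u v) evalxy_monoid.

Lemma evalxyX : evalxy h u v 'X = v.
Proof. by rewrite /evalxy map_polyX hornerX. Qed.

Lemma evalxyC p : evalxy h u v p%:P = evalx h u p.
Proof. by rewrite /evalxy map_polyC hornerC. Qed.

End Evaluation.

Section ChainRule.
Variable K : fieldType.
Implicit Types F G : {poly {poly K}}.

Lemma dx_derivation : derivation (@dx K).
Proof.
split=> F G; apply/polyP => i.
  by rewrite coefD /dx !coef_map_id0 ?deriv0 // coefD derivD.
rewrite coefD !coefM /dx coef_map_id0 ?deriv0 // coefM linear_sum -big_split.
by apply: eq_bigr => j _; rewrite /= !coef_map_id0 ?deriv0 // derivM.
Qed.

Lemma dxC (p : {poly K}) : dx p%:P = (p^`())%:P.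
Proof.
apply/polyP => i; rewrite coef_map_id0 ?deriv0 // !coefC.
by case: ifP; rewrite ?deriv0.
Qed.

Lemma dx_vary : dx (vary : {poly {poly K}}) = 0.
Proof.
apply/polyP => i; rewrite coef_map_id0 ?deriv0 // coefX coef0.
by case: (i == 1%N); rewrite ?deriv0 // -[1%:R]/(1%:P) derivC.
Qed.

Lemma dy_derivation : derivation (@dy K).
Proof. by split=> F G; rewrite /dy ?derivD ?derivM. Qed.

Variables (S : comNzRingType) (h : {rmorphism K -> S}) (u v : S).

Lemma evalx_chain (d : S -> S) (p : {poly K}) :
    derivation d -> (forall c, d (h c) = 0) ->
  d (evalx h u p) = evalx h u p^`() * d u.
Proof.
move=> der dh; have [dD dM] := der.
elim/poly_ind: p => [|p c IHp]; first by rewrite deriv0 !rmorph0 mul0r derivation0.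
rewrite rmorphD rmorphM /= evalxX evalxC dD dM dh IHp.
by rewrite derivD derivM derivC derivX !addr0 mulr1 rmorphD rmorphM /= evalxX; ring.
Qed.

Lemma evalxy_chain (d : S -> S) F :
    derivation d -> (forall c, d (h c) = 0) ->
  d (evalxy h u v F) = evalxy h u v (dx F) * d u + evalxy h u v (dy F) * d v.
Proof.
move=> der dh; have [dD dM] := der.
have [dxD dxM] := dx_derivation.
elim/poly_ind: F => [|F p IHF].
  rewrite /dy deriv0 !rmorph0 (derivation0 dx_derivation) rmorph0.
  by rewrite !mul0r addr0 derivation0.
rewrite rmorphD rmorphM /= evalxyX evalxyC dD dM IHF evalx_chain //.
rewrite dxD dxM dxC dx_vary mulr0 addr0 /dy derivD derivM derivC derivX.
by rewrite addr0 mulr1 !rmorphD !rmorphM /= evalxyX evalxyC; ring.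
Qed.

(** Arbitrary derivations of the target cover both uses: the partial derivatives
    of the plane for the shear, and [t d/dt] and [d/d pi] for the substitution of
    a pi-approximation.  The proof expands the chain rule. *)
Lemma evalxy_jac (d1 d2 : S -> S) F G :
    derivation d1 -> derivation d2 ->
    (forall c, d1 (h c) = 0) -> (forall c, d2 (h c) = 0) ->
  d1 (evalxy h u v F) * d2 (evalxy h u v G)
    - d1 (evalxy h u v G) * d2 (evalxy h u v F)
  = evalxy h u v (jac F G) * (d1 u * d2 v - d1 v * d2 u).
Proof.
move=> der1 der2 dh1 dh2.
rewrite (evalxy_chain F der1 dh1) (evalxy_chain G der1 dh1).
rewrite (evalxy_chain G der2 dh2) (evalxy_chain F der2 dh2).
have -> : evalxy h u v (jac F G) = evalxy h u v (dx F) * evalxy h u v (dy G)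
                                   - evalxy h u v (dx G) * evalxy h u v (dy F).
  by rewrite /jac rmorphD rmorphN !rmorphM.
by ring.
Qed.

End ChainRule.

Section Psi.
Variable K : fieldType.
Implicit Types F G : {poly {poly K}}.

Definition polyCC : {rmorphism K -> {poly {poly K}}} := polyC \o polyC.

Lemma psiE F : psi F = evalxy polyCC (varx + vary) vary F.
Proof. by []. Qed.

Lemma psi_jac F G : jac (psi F) (psi G) = psi (jac F G).
Proof.
have [dxD _] := dx_derivation K; have [dyD _] := dy_derivation K.
rewrite {1}/jac !psiE evalxy_jac; first last.
- by move=> c; rewrite /= /dy derivC.
- by move=> c; rewrite /= dxC derivC.
- exact: dy_derivation.
- exact: dx_derivation.
rewrite dxD dyD dx_vary /varx dxC /dy derivC derivX derivX -/vary.
by rewrite [polyC (_ 1)]rmorph1 !add0r addr0 mulr1 mul0r subr0 mulr1.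
Qed.

Lemma psi_jac_unit F G : jac_unit F G -> jac_unit (psi F) (psi G).
Proof.
move=> [c c0 E]; exists c => //; rewrite psi_jac E psiE.
by rewrite evalxyC evalxC.
Qed.

End Psi.

(** * The shear makes the polynomials monic *)

Section Shear.
Variable K : fieldType.
Implicit Types (F G : {poly {poly K}}) (p : nat * nat).

Lemma coef_mono (c : K) p i j :
  (mono c p)`_j`_i = if (i == p.1) && (j == p.2) then c else 0.
Proof.
rewrite /mono /varx -rmorphXn -rmorphM coefCM coefXn.
case: (j == p.2); last by rewrite mulr0 coef0 andbF.
by rewrite mulr1 andbT coefCM coefXn; case: eqP; rewrite ?mulr1 ?mulr0.
Qed.

Lemma mem_support F p : (p \in Defs.support F) = (F`_p.2`_p.1 != 0).
Proof.
rewrite mem_filter andb_idr // => Fp0; case: p Fp0 => i j /= Fji.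
have ltj : (j < size F)%N.
  by rewrite ltnNge; apply: contra Fji => /(nth_default 0) ->; rewrite coef0.
apply/allpairsPdep; exists j, i; split=> //; rewrite mem_iota add0n //=.
by rewrite ltnNge; apply: contra Fji => /(nth_default 0) ->.
Qed.

Lemma support_uniq F : uniq (Defs.support F).
Proof.
apply/filter_uniq/allpairs_uniq_dep; rewrite ?iota_uniq //.
  by move=> j _; exact: iota_uniq.
by move=> [j i] [j' i'] _ _ /= [-> ->].
Qed.

Lemma vpt_le_v rho sigma F p : p \in Defs.support F -> vpt rho sigma p <= v rho sigma F.
Proof.
move=> /(map_f (vpt rho sigma)); rewrite /v; move: (head _ _) => z0.
elim: map => //= z s IHs; rewrite inE big_cons le_max => /orP[/eqP ->|/IHs ->].
  by rewrite lexx.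
by rewrite orbT.
Qed.

Lemma coef_lead rho sigma F i j :
  (lead rho sigma F)`_j`_i =
  if vpt rho sigma (i, j) == v rho sigma F then F`_j`_i else 0.
Proof.
rewrite /lead !coef_sum -big_filter.
have us := filter_uniq (fun p => vpt rho sigma p == v rho sigma F) (support_uniq F).
have [ij_in|ij_out] := boolP ((i, j) \in
    [seq p <- Defs.support F | vpt rho sigma p == v rho sigma F]).
  rewrite (bigD1_seq (i, j)) //= coef_mono !eqxx big1 ?addr0 => [|p nep].
    by move: ij_in; rewrite mem_filter => /andP[->].
  rewrite coef_mono; case: ifP => // /andP[/eqP Ei /eqP Ej].
  by case/eqP: nep; case: p Ei Ej => /= ? ? -> ->.
rewrite big_seq big1 => [|p p_in]; last first.
  rewrite coef_mono; case: ifP => // /andP[/eqP Ei /eqP Ej].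
  by move: ij_out; rewrite Ei Ej -surjective_pairing p_in.
move: ij_out; rewrite mem_filter mem_support negb_and negbK /=.
by case: eqP => //= _ /eqP ->.
Qed.

Lemma psi_expand F : psi F =
  \sum_(j < size F)
     (\sum_(i < size F`_j) (F`_j`_i)%:P%:P * (vary + varx) ^+ i) * vary ^+ j.
Proof.
have E (p : {poly {poly K}}) : p = \sum_(j < size p) (p`_j)%:P * 'X^j.
  by rewrite -[LHS]coefK poly_def; apply: eq_bigr => j _; rewrite mul_polyC.
have E' (p : {poly K}) : p = \sum_(j < size p) (p`_j)%:P * 'X^j.
  by rewrite -[LHS]coefK poly_def; apply: eq_bigr => j _; rewrite mul_polyC.
rewrite psiE {1}(E F) rmorph_sum; apply: eq_bigr => j _.
rewrite rmorphM rmorphXn /= evalxyX evalxyC {1}(E' F`_j) rmorph_sum; congr (_ * _).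
apply: eq_bigr => i _; rewrite rmorphM rmorphXn /= evalxX evalxC.
by rewrite [varx + _]addrC.
Qed.

Lemma sheared_monomial i j :
  ((vary + varx) ^+ i * vary ^+ j : {poly {poly K}}) \is monic /\
  size ((vary + varx) ^+ i * vary ^+ j : {poly {poly K}}) = (i + j).+1.
Proof.
have -> : vary + varx = 'X - (- 'X)%:P :> {poly {poly K}} by rewrite polyCN opprK.
have mon1 : ('X - (- 'X)%:P) ^+ i \is @monic {poly K} by rewrite monic_exp ?monicXsubC.
split; first by rewrite monicMr ?monicXn.
by rewrite size_mulXn ?monic_neq0 // size_exp_XsubC addnS addnC.
Qed.

Lemma size_psi_lt F N :
  (forall i j, F`_j`_i != 0 -> (i + j < N)%N) -> (size (psi F) <= N)%N.
Proof.
move=> FN; rewrite psi_expand.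
apply: leq_trans (size_sum _ _ _) _; apply/bigmax_leqP => j _.
rewrite mulr_suml.
apply: leq_trans (size_sum _ _ _) _; apply/bigmax_leqP => i _.
have [->|Fji] := eqVneq F`_j`_i 0; first by rewrite !mul0r size_poly0.
rewrite -mulrA mul_polyC; apply: leq_trans (size_scale_leq _ _) _.
by rewrite (proj2 (sheared_monomial _ _)); exact: FN.
Qed.

(** The shear turns the top form [x^a y^b] into [(x + y)^a y^b], which is monic in
    [y] of degree [a + b]; the terms of lower total degree stay below. *)
Lemma psi_monic F a b : lead 1 1 F = varx ^+ a * vary ^+ b ->
  psi F \is monic /\ size (psi F) = (a + b).+1.
Proof.
move=> leadF.
have monoE : varx ^+ a * vary ^+ b = mono 1 (a, b) :> {poly {poly K}}.
  by rewrite /mono !polyC1 mul1r.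
have coefF i j : (if vpt 1 1 (i, j) == v 1 1 F then F`_j`_i else 0)
    = if (i == a) && (j == b) then 1 else 0.
  by rewrite -coef_lead leadF monoE coef_mono.
have [vab Fab] : vpt 1 1 (a, b) = v 1 1 F /\ F`_b`_a = 1.
  have := coefF a b; rewrite !eqxx /=; case: eqP => // _ /esym/eqP.
  by rewrite oner_eq0.
pose G := F - varx ^+ a * vary ^+ b.
have sizeG : (size (psi G) <= a + b)%N.
  apply: size_psi_lt => i j; rewrite !coefB monoE coef_mono /=.
  have := coefF i j; rewrite -vab /vpt /= !mul1r.
  case: eqP => [_ ->|ne _]; first by rewrite subrr eqxx.
  case: andP => [[/eqP Ei /eqP Ej]|_]; first by case: ne; rewrite Ei Ej.
  rewrite subr0 => Fji; have : (i, j) \in Defs.support F by rewrite mem_support.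
  by move=> /(vpt_le_v 1 1); rewrite -vab /vpt /= !mul1r; lia.
have [monM szM] := sheared_monomial a b.
have -> : psi F = (vary + varx) ^+ a * vary ^+ b + psi G.
  rewrite -[F in LHS](subrK (varx ^+ a * vary ^+ b)) -/G [RHS]addrC !psiE rmorphD.
  rewrite rmorphM !rmorphXn /= evalxyX; congr (_ + _ ^+ _ * _).
  by rewrite /varx evalxyC evalxX addrC.
rewrite size_polyDl; last by rewrite szM ltnS.
by rewrite monicE lead_coefDl ?szM ?ltnS // -monicE.
Qed.

End Shear.

(** * Pi-roots in terms of differences of roots *)

Lemma rmorph_evalx (K S T : comNzRingType) (h : {rmorphism K -> S})
    (g : {rmorphism S -> T}) (u : S) (p : {poly K}) :
  g (evalx h u p) = evalx (g \o h) (g u) p.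
Proof. by rewrite /evalx map_poly_comp horner_map. Qed.

Section PiSeries.
Variable K : fieldType.
Implicit Types (alpha beta : laurent K) (tau : pi_approx K).
Implicit Types (roots : seq (laurent K)) (F G : {poly {poly K}}) (i j : int).

Definition to_series (l : nat) : {poly K} -> laurent K :=
  evalx (@lconst K) (lmon 1 l%:Z).
HB.instance Definition _ l := GRing.RMorphism.on (to_series l).

Lemma root_multiset_monic l F roots : F \is monic ->
  root_multiset l F roots <->
  map_poly (to_series l) F = \prod_(alpha <- roots) ('X - alpha%:P).
Proof.
move=> monF; rewrite /root_multiset (monicP monF).
by rewrite -/(to_series l) rmorph1 scale1r.
Qed.

Definition lies_on tau alpha : Prop :=
  forall k : nat, lcoef alpha (tau.1 + 1 + k%:Z) = tau.2`_k.

Definition agree i alpha beta : bool :=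
  `[< forall j, i < j -> lcoef alpha j = lcoef beta j >].

(** The exponent of the leading term of [tau - beta], for a pi-approximation
    [tau] of order [i] of [alpha]. *)
Definition contact i alpha beta : int :=
  if agree i alpha beta then i else ldeg (alpha - beta).

Definition contacts i alpha roots : int := \sum_(beta <- roots) contact i alpha beta.

(** The coefficients at [i] of the roots that agree with [alpha] above [i]; these
    are the roots of the polynomial attached to the pi-approximation. *)
Definition branch i alpha roots : seq K :=
  [seq lcoef beta i | beta <- roots & agree i alpha beta].

Lemma agreeP i alpha beta :
  reflect (forall j, i < j -> lcoef alpha j = lcoef beta j) (agree i alpha beta).
Proof. exact: asboolP. Qed.

Lemma agree_refl i alpha : agree i alpha alpha.
Proof. by apply/agreeP. Qed.

Lemma agreeW i j alpha beta : i <= j -> agree i alpha beta -> agree j alpha beta.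
Proof. by move=> leij /agreeP H; apply/agreeP => k ltk; apply: H; lia. Qed.

Lemma agree_pred i alpha beta :
  agree (i - 1) alpha beta = agree i alpha beta && (lcoef beta i == lcoef alpha i).
Proof.
apply/idP/andP => [H|[/agreeP H /eqP E]].
  split; first by apply: agreeW H; lia.
  by move/agreeP: H => H; apply/eqP/esym/H; lia.
apply/agreeP => j ltj; have [->|ltij] := eqVneq j i; first by rewrite E.
by apply: H; lia.
Qed.

Lemma lies_on_ge tau alpha j : lies_on tau alpha -> tau.1 < j ->
  lcoef alpha j = tau.2`_(absz (j - tau.1 - 1)%R).
Proof. by move=> H ltj; rewrite -H; congr (lcoef _ _); lia. Qed.

Lemma mem_D tau alpha roots :
  (alpha \in D roots tau) = (alpha \in roots) && `[< lies_on tau alpha >].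
Proof. by rewrite mem_filter andbC. Qed.

Lemma lies_on_exists i alpha : exists2 tau, tau.1 = i & lies_on tau alpha.
Proof.
have [N aN] := lcoef_bounded alpha.
exists (i, \poly_(k < absz (N - i)%R) lcoef alpha (i + 1 + k%:Z)) => //= k /=.
rewrite coef_poly; case: ltnP => // lek; rewrite aN //; lia.
Qed.

Lemma lies_on_inj tau tau' alpha :
  lies_on tau alpha -> lies_on tau' alpha -> tau.1 = tau'.1 -> tau = tau'.
Proof.
case: tau tau' => [i p] [i' p'] H H' /= E; congr pair => //.
by apply/polyP => k; rewrite -(H k) -(H' k) /= E.
Qed.

(** The finite sum in a pi-approximation is the truncation of any series that lies
    on it. *)
Lemma lcoef_pi_series tau alpha j : lies_on tau alpha ->
  lcoef (pi_series tau) j =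
    if j == tau.1 then 'X else if tau.1 < j then (lcoef alpha j)%:P else 0.
Proof.
move=> Ha; rewrite /pi_series lcoefD lcoef_mon lcoef_sum.
have [lejt|ltj] := lerP j tau.1.
  rewrite big1 ?add0r // => k _; rewrite lcoef_mon ifF //; lia.
rewrite [X in _ + X]ifF ?addr0; last by lia.
rewrite ifF; last by lia.
rewrite (lies_on_ge Ha ltj); set k := absz _.
have jk : j = tau.1 + 1 + k%:Z by rewrite /k; lia.
have [ltk|lek] := ltnP k (size tau.2).
  rewrite (bigD1 (Ordinal ltk)) //= jk eqxx big1 ?addr0 // => k' nek.
  by rewrite ifF //; apply/negP => /eqP E; case/negP: nek; apply/eqP/val_inj => /=; lia.
rewrite nth_default // big1 // => k' _; rewrite lcoef_mon ifF //.
by have := ltn_ord k'; lia.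
Qed.

(** The term [pi t^i] lies below the first disagreement, so the difference with
    [alpha] governs the difference with its pi-approximation of order [i]. *)
Lemma disagree_lead i alpha beta : ~~ agree i alpha beta ->
  exists2 c, c != 0 & i < ldeg (alpha - beta) /\
                      has_lead (alpha - beta) (ldeg (alpha - beta)) c.
Proof.
move=> Nab; have [|e [c [c0 ab]]] := @exists_lead _ (alpha - beta).
  by rewrite subr_eq0; apply: contraNneq Nab => ->; exact: agree_refl.
exists c; rewrite ?(has_lead_ldeg c0 ab) //; split=> //; rewrite ltNge.
apply: contra Nab => lei; apply/agreeP => j ltj; apply/eqP.
by rewrite -subr_eq0 -lcoefB (proj2 ab) //; lia.
Qed.

Definition lead_factor i alpha beta : {poly K} :=
  if agree i alpha beta then 'X - (lcoef beta i)%:P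
  else (lcoef (alpha - beta) (ldeg (alpha - beta)))%:P.

Lemma pi_series_sub_lead tau alpha beta : lies_on tau alpha ->
  has_lead (pi_series tau - lmap (@polyC K) beta)
    (contact tau.1 alpha beta) (lead_factor tau.1 alpha beta).
Proof.
move=> Ha; rewrite /contact /lead_factor.
have lcE j : lcoef (pi_series tau - lmap (@polyC K) beta) j =
    (if j == tau.1 then 'X else if tau.1 < j then (lcoef alpha j)%:P else 0)
      - (lcoef beta j)%:P by rewrite lcoefB (lcoef_pi_series _ Ha).
case: ifPn => [/agreeP ab|/disagree_lead [c c0 [lti [cE ab0]]]].
  split=> [|j ltj]; rewrite lcE ?eqxx //.
  by rewrite ltj ifF ?ab ?subrr //; lia.
split=> [|j ltj]; rewrite lcE ifF ?ifT; try lia; rewrite -polyCB //.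
by rewrite -lcoefB ab0 ?polyC0.
Qed.

Lemma subst_pi_prod l F roots tau : F \is monic -> root_multiset l F roots ->
  subst_pi l F tau = \prod_(beta <- roots) (pi_series tau - lmap (@polyC K) beta).
Proof.
move=> monF /(root_multiset_monic l roots monF) E.
have -> : subst_pi l F tau =
    (map_poly (lmap (@polyC K)) (map_poly (to_series l) F)).[pi_series tau].
  rewrite -map_poly_comp /subst_pi /evalxy; congr (_ .[_]).
  apply: eq_map_poly => p; rewrite /to_series [RHS]rmorph_evalx /evalx.
  congr (_.[_]); last first.
    by apply: esym; rewrite -[1 in RHS](rmorph1 (@polyC K)); exact: lmap_mon.
  by congr (map_poly _ _); apply/funext => c; exact/esym/lmap_mon.
rewrite E rmorph_prod horner_prod; apply: eq_bigr => beta _.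
by rewrite /= rmorphB /= map_polyX map_polyC !hornerE.
Qed.

(** Leading terms multiply in the factorization of [F(tau)] into the differences
    [tau - beta], so the roots of the leading polynomial and the degree can be read
    off from the roots of [F]. *)
Lemma subst_pi_lead l F roots tau alpha :
    F \is monic -> root_multiset l F roots -> lies_on tau alpha ->
  exists2 c : K, c != 0 &
    has_lead (subst_pi l F tau) (contacts tau.1 alpha roots)
      (c *: \prod_(z <- branch tau.1 alpha roots) ('X - z%:P)).
Proof.
move=> monF rF Ha.
pose c := \prod_(beta <- roots | ~~ agree tau.1 alpha beta)
  lcoef (alpha - beta) (ldeg (alpha - beta)).
exists c.
  rewrite prodf_seq_neq0; apply/allP => beta _; apply/implyP => /disagree_lead.
  by move=> [d d0 [_ [-> _]]].
rewrite (subst_pi_prod tau monF rF).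
have -> : c *: \prod_(z <- branch tau.1 alpha roots) ('X - z%:P) =
    \prod_(beta <- roots) lead_factor tau.1 alpha beta.
  rewrite /lead_factor (bigID (agree tau.1 alpha)) /= mulrC -mul_polyC rmorph_prod.
  congr (_ * _); first by apply: eq_bigr => beta /negPf ->.
  by rewrite big_map big_filter; apply: eq_bigr => beta ->.
by apply: has_lead_prod => beta _; exact: pi_series_sub_lead.
Qed.

End PiSeries.

(** * The differential equation for the leading polynomials *)

Section Bracket.
Variable K : fieldType.

Lemma has_lead_ltheta (f : laurent {poly K}) i c :
  has_lead f i c -> has_lead (ltheta f) i (i%:~R * c).
Proof. by move=> [<- f0]; split=> // j /f0 /= ->; rewrite mulr0. Qed.

Lemma has_lead_lderiv (f : laurent {poly K}) i c :
  has_lead f i c -> has_lead (lderiv f) i c^`().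
Proof. by move=> [<- f0]; split=> // j /f0 /= ->; rewrite deriv0. Qed.

(** Substituting [x = t^l] and [y = tau] turns a constant Jacobian into a single
    monomial with constant coefficient, because [tau] depends on [pi] through
    [pi t^i] only.  Whatever the position of that monomial, the coefficient at
    the sum of the leading exponents is a constant polynomial in [pi]. *)
Lemma bracket_constant l (F G : {poly {poly K}}) tau alpha (c : K) p q f g :
    jac F G = c%:P%:P -> lies_on tau alpha ->
    has_lead (subst_pi l F tau) p f -> has_lead (subst_pi l G tau) q g ->
  exists k : K, p%:~R * (f * g^`()) - q%:~R * (g * f^`()) = k%:P.
Proof.
move=> jacFG Ha hF hG.
pose h : {rmorphism K -> laurent {poly K}} := @lconst {poly K} \o @polyC K.
pose u : laurent {poly K} := lmon 1 l%:Z.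
pose w := pi_series tau.
have th0 a : ltheta (h a) = 0.
  by apply: laurentP => j /=; case: eqP => [->|]; rewrite ?mul0r ?mulr0.
have dh0 a : lderiv (h a) = 0.
  by apply: laurentP => j /=; case: eqP; rewrite ?derivC ?deriv0.
have du : lderiv u = 0.
  by apply: laurentP => j /=; case: eqP; rewrite ?deriv0 // -[1]/(1%:P) derivC.
have tu : ltheta u = lmon (l%:R%:P) l%:Z.
  apply: laurentP => j /=; case: eqP => [->|]; rewrite ?mulr0 ?mulr1 //.
  by rewrite polyC_natr.
have dw : lderiv w = lmon 1 tau.1.
  apply: laurentP => j; rewrite -[LHS]/((lcoef (pi_series tau) j)^`()).
  rewrite (lcoef_pi_series _ Ha) lcoef_mon.
  case: eqP => _; first by rewrite derivX.
  by case: ifP; rewrite ?derivC ?deriv0.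
have := evalxy_jac u w F G (@ltheta_derivation {poly K}) (@lderiv_derivation K) th0 dh0.
rewrite jacFG evalxyC evalxC du mulr0 subr0 tu dw.
rewrite -/(subst_pi l F tau) -/(subst_pi l G tau).
move/(congr1 (fun s => lcoef s (p + q))).
rewrite lcoefB (proj1 (has_leadM (has_lead_ltheta hF) (has_lead_lderiv hG))).
rewrite [in X in _ - X]addrC.
rewrite (proj1 (has_leadM (has_lead_ltheta hG) (has_lead_lderiv hF))) => E.
exists (if p + q == l%:Z + tau.1 then c * l%:R else 0).
rewrite !mulrA E lmonM [h c]/= /lconst lmonM lcoef_mon add0r mulr1 -polyCM.
by case: ifP.
Qed.

End Bracket.

Section LeadingPolynomials.
Variable K : fieldType.
Implicit Types (f g : {poly K}) (s : seq K) (p q : int).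

(** A multiple root of [f] is a root of [f] and [f'], hence of the bracket. *)
Lemma bracket_neq0_mup f g p q (k : K) z :
    k != 0 -> p%:~R * (f * g^`()) - q%:~R * (g * f^`()) = k%:P ->
  (mup z f <= 1)%N.
Proof.
move=> k0 E; have f0 : f != 0.
  apply: contraNneq k0 => f0; rewrite f0 deriv0 mul0r !mulr0 subr0 in E.
  by rewrite -polyC_eq0 -E.
rewrite mup_leq //; apply/negP => /dvdpP [r fE]; case/eqP: k0.
rewrite expr2 in fE.
have fz : f.[z] = 0 by rewrite fE !hornerM !hornerXsubC subrr !mulr0.
have dfz : f^`().[z] = 0.
  rewrite fE !derivM !derivXsubC !(hornerXsubC, hornerM, hornerD).
  by rewrite subrr !(mulr0, mul0r, addr0).
have := congr1 (fun r => r.[z]) E.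
by rewrite /= hornerD hornerN !hornerM fz dfz hornerC !(mulr0, mul0r) subr0 => <-.
Qed.

Lemma bracket_neq0_coprime f g p q (k : K) :
    k != 0 -> p%:~R * (f * g^`()) - q%:~R * (g * f^`()) = k%:P ->
  coprimep f g.
Proof.
move=> k0 E; apply/Bezout_coprimepP.
exists (p%:~R * g^`(), - (q%:~R * f^`())) => /=.
rewrite (_ : _ + _ = k%:P); last by rewrite -E; ring.
by rewrite polyC_eqp1.
Qed.

Hypothesis K_char0 : [pchar K] =i pred0.

Lemma intr_eq0_char0 (z : int) : (z%:~R == 0 :> K) = (z == 0).
Proof.
have /pcharf0P natr0 := K_char0.
by case: z => n; rewrite ?NegzE ?mulrNz ?oppr_eq0 -pmulrn natr0.
Qed.

Lemma deriv_XsubC_factor f z : f != 0 -> exists2 r : {poly K},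
  r.[z] != 0 & f = ('X - z%:P) ^+ mup z f * r /\
  ('X - z%:P) * f^`() =
    ('X - z%:P) ^+ mup z f * ((mup z f)%:R * r + ('X - z%:P) * r^`()).
Proof.
move=> f0; have [u [r]] := multiplicity_XsubC f z; rewrite f0 /= => rz fE.
have uE : mup z f = u.
  by rewrite fE mupMr // mup_XsubCX eqxx.
exists r; rewrite ?uE -?rootE //; split; first by rewrite fE mulrC.
rewrite {1}fE derivM deriv_exp derivXsubC mul1r.
case: u {fE uE} => [|u]; first by rewrite !expr0 mulr0n mulr0 addr0; ring.
by rewrite -mulr_natr /= exprS; ring.
Qed.

(** The equation says that [p g'/g = q f'/f]; compare the residues at [z]. *)
Lemma bracket_eq0_mup f g p q z :
    f != 0 -> g != 0 -> p%:~R * (f * g^`()) - q%:~R * (g * f^`()) = 0 ->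
  p * (mup z g)%:Z = q * (mup z f)%:Z.
Proof.
move=> f0 g0 E.
have [r rz [fE dfE]] := deriv_XsubC_factor z f0.
have [s sz [gE dgE]] := deriv_XsubC_factor z g0.
move: dfE dgE fE gE; set u := mup z f; set w := mup z g => dfE dgE fE gE.
have X0 n : ('X - z%:P) ^+ n != 0 by rewrite expf_neq0 // polyXsubC_eq0.
have /(congr1 ( *%R ('X - z%:P))) := E; rewrite mulr0.
rewrite (_ : _ * _ = ('X - z%:P) ^+ (u + w) *
   (p%:~R * (r * (w%:R * s + ('X - z%:P) * s^`()))
    - q%:~R * (s * (u%:R * r + ('X - z%:P) * r^`())))); last first.
  transitivity (p%:~R * (f * (('X - z%:P) * g^`()))
                - q%:~R * (g * (('X - z%:P) * f^`()))); first by ring.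
  by rewrite dfE dgE {1}fE {1}gE exprD; ring.
move/eqP; rewrite mulf_eq0 (negPf (X0 _)) /= => /eqP/(congr1 (horner^~ z)).
rewrite /= -!(rmorph_int (@polyC K)) -!(rmorph_nat (@polyC K)) !hornerE.
rewrite subrr !mul0r !addr0 => {}E.
apply/eqP; rewrite -subr_eq0 -intr_eq0_char0.
have : ((p * w - q * u)%:~R * (r.[z] * s.[z]) == 0 :> K).
  by rewrite -E rmorphB !rmorphM /= -!pmulrn; apply/eqP; ring.
by rewrite mulf_eq0 mulf_eq0 (negPf rz) (negPf sz) !orbF.
Qed.

Lemma mup_scale_prod (c : K) s z :
  c != 0 -> mup z (c *: \prod_(y <- s) ('X - y%:P)) = count_mem z s.
Proof.
move=> c0; rewrite -mul_polyC mupMr ?mu_prod_XsubC //.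
by rewrite rootC.
Qed.

Lemma mup_le1_uniq (c : K) s :
    c != 0 -> (forall z, (mup z (c *: \prod_(y <- s) ('X - y%:P)%R) <= 1)%N) ->
  uniq s.
Proof.
move=> c0 H; apply: count_mem_uniq => z.
have := H z; rewrite mup_scale_prod // -has_pred1 has_count.
by case: (count_mem z s) => [|[]].
Qed.

Lemma coprimep_disjoint (c c' : K) s s' :
    c != 0 -> c' != 0 ->
    coprimep (c *: \prod_(y <- s) ('X - y%:P)) (c' *: \prod_(y <- s') ('X - y%:P)) ->
  forall z, z \in s -> z \notin s'.
Proof.
move=> c0 c'0; rewrite coprimepZl // coprimepZr // => co z zs.
have /(coprimep_root co) : root (\prod_(y <- s) ('X - y%:P)) z.
  by rewrite root_prod_XsubC.
by rewrite -rootE root_prod_XsubC.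
Qed.

End LeadingPolynomials.

(** * Descending along a root *)

Section Contacts.
Variable K : fieldType.
Implicit Types (alpha beta : laurent K) (roots : seq (laurent K)) (i j : int).

(** A root that agrees above [i] but not at [i] is at distance exactly [i] from
    [alpha], so at this order both conventions give the same value. *)
Lemma agree_pred_contact i alpha beta :
  contact i alpha beta = if agree (i - 1) alpha beta then i else ldeg (alpha - beta).
Proof.
rewrite /contact agree_pred; case: ifP => //= /agreeP ab; case: eqP => // Nab.
apply/esym/(@has_lead_ldeg _ _ _ (lcoef alpha i - lcoef beta i)).
  by rewrite subr_eq0 eq_sym; apply/eqP.
by split=> // j /ab; rewrite lcoefB => ->; rewrite subrr.
Qed.

Lemma contacts_pred i alpha roots :
  contacts (i - 1) alpha roots =
  contacts i alpha roots - (size (branch (i - 1) alpha roots))%:Z.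
Proof.
rewrite /contacts /branch size_map; elim: roots => [|beta roots IH] /=.
  by rewrite !big_nil subr0.
rewrite !big_cons IH (agree_pred_contact i) /contact.
by case: ifP => _ /=; lia.
Qed.

Lemma size_branch_pred i alpha roots :
  size (branch (i - 1) alpha roots) = count_mem (lcoef alpha i) (branch i alpha roots).
Proof.
rewrite /branch size_map count_map size_filter count_filter.
by apply: eq_count => beta /=; rewrite agree_pred andbC.
Qed.

Lemma mem_branch i alpha roots :
  alpha \in roots -> lcoef alpha i \in branch i alpha roots.
Proof. by move=> a_r; apply: map_f; rewrite mem_filter agree_refl. Qed.

Lemma contacts_top i alpha roots : {in roots, forall beta, agree i alpha beta} ->
  contacts i alpha roots = i * (size roots)%:Z /\
  size (branch i alpha roots) = size roots.
Proof.
move=> H; split.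
  rewrite /contacts (eq_big_seq (fun=> i)); last by move=> beta /H; rewrite /contact => ->.
  by rewrite big_const_seq count_predT iter_addr_0 -mulr_natr natz.
by rewrite size_map; have /all_filterP -> : all (agree i alpha) roots by apply/allP.
Qed.

Lemma agree_eventually alpha roots :
  exists2 i, 0 < i & {in roots, forall beta, agree i alpha beta}.
Proof.
elim: roots => [|beta roots [i i0 H]]; first by exists 1.
have [N abN] := lcoef_bounded (alpha - beta).
exists (Num.max i N); first by rewrite lt_max i0.
move=> gamma; rewrite inE => /orP[/eqP ->|/H]; last first.
  by apply: agreeW; rewrite le_max lexx.
apply/agreeP => j; rewrite gt_max => /andP[_ /abN /eqP].
by rewrite lcoefB subr_eq0 => /eqP.
Qed.

End Contacts.

Section FractionalOrder.
Variable K : fieldType.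
Variables (d : nat) (d_gt0 : (0 < d)%N).
Implicit Types (alpha beta : laurent K) (roots : seq (laurent K)) (i j : int).

Local Notation stretch := (@lstretch K d d_gt0).

Lemma has_lead_stretch (f : laurent K) i c :
  has_lead f i c -> has_lead (stretch f) (i * d%:Z) c.
Proof.
move=> [fi f0]; split=> [|j ltj]; first by rewrite lstretch_mul.
have [/divzK dj|/lstretch_ndvd -> //] := boolP (d %| j)%Z.
by rewrite -dj lstretch_mul; apply: f0; nia.
Qed.

Lemma agree_stretch i j alpha beta :
    (i - 1) * d%:Z <= j -> j < i * d%:Z ->
  agree j (stretch alpha) (stretch beta) = agree (i - 1) alpha beta.
Proof.
move=> lej ltj; apply/agreeP/agreeP => H k ltk.
  by rewrite -(lstretch_mul d_gt0 alpha) -(lstretch_mul d_gt0 beta); apply: H; nia.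
have [/divzK dk|Ndk] := boolP (d %| k)%Z; last by rewrite !lstretch_ndvd.
by rewrite -dk !lstretch_mul; apply: H; nia.
Qed.

Lemma root_multiset_stretch l (F : {poly {poly K}}) roots :
    F \is monic -> root_multiset l F roots ->
  root_multiset (l * d) F [seq stretch beta | beta <- roots].
Proof.
move=> monF /(root_multiset_monic _ _ monF) E; apply/(root_multiset_monic _ _ monF).
have -> : map_poly (to_series (l * d)) F = map_poly stretch (map_poly (to_series l) F).
  rewrite -map_poly_comp; apply: eq_map_poly => p /=.
  rewrite /to_series [RHS]rmorph_evalx /evalx; congr (_.[_]).
    by congr (map_poly _ _); apply/funext => c; rewrite /= /lconst lstretch_mon mul0r.
  by rewrite [RHS]lstretch_mon; congr lmon; lia.
rewrite E rmorph_prod big_map; apply: eq_bigr => beta _.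
by rewrite /= rmorphB /= map_polyX map_polyC.
Qed.

(** In the variable of the ramified extension, the orders between [i - 1] and [i]
    with denominator [d] become integral.  Over that range the contact with the roots
    that agree above [i - 1] follows the order, and the other contacts are fixed. *)
Lemma contacts_stretch i p alpha roots :
    0 < p -> p <= d%:Z ->
  contacts (i * d%:Z - p) (stretch alpha) [seq stretch beta | beta <- roots] =
  contacts i alpha roots * d%:Z - p * (size (branch (i - 1) alpha roots))%:Z.
Proof.
move=> p0 pd; rewrite /contacts /branch size_map.
elim: roots => [|beta roots IH] /=; first by rewrite !big_nil; lia.
rewrite !big_cons IH (agree_pred_contact i) /contact (@agree_stretch i); try nia.
case: ifPn => [_|/disagree_lead [c c0 [_ /has_lead_stretch]]] /=; first by nia.
by rewrite rmorphB => /(has_lead_ldeg c0) ->; nia.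
Qed.

(** At an order that is not a multiple of [d] every stretched root has coefficient
    zero. *)
Lemma branch_stretch i j alpha roots :
    (i - 1) * d%:Z < j -> j < i * d%:Z ->
  branch j (stretch alpha) [seq stretch beta | beta <- roots] =
  nseq (size (branch (i - 1) alpha roots)) 0.
Proof.
move=> lej ltj; have Ndj : ~~ (d %| j)%Z.
  apply/negP => /divzK dj; move: lej ltj.
  by rewrite -dj !ltr_pM2r ?ltz_nat //; lia.
rewrite /branch !size_map filter_map -map_comp.
rewrite (eq_map (g := fun=> 0)); last by move=> beta; exact: lstretch_ndvd.
rewrite (eq_filter (a2 := agree (i - 1) alpha)); last first.
  by move=> beta /=; rewrite (@agree_stretch i) // ltW.
by elim: [seq _ <- _ | _] => //= ? ? ->.
Qed.

End FractionalOrder.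

Section Descent.
Variables (K : fieldType) (K_char0 : [pchar K] =i pred0).
Variables (P Q : {poly {poly K}}) (l : nat) (rootsP rootsQ : seq (laurent K)).
Hypotheses (l_gt0 : (0 < l)%N) (monP : P \is monic) (monQ : Q \is monic).
Hypotheses (rP : root_multiset l P rootsP) (rQ : root_multiset l Q rootsQ).
Hypothesis genPQ : generic P Q.
Implicit Types (alpha beta : laurent K) (tau : pi_approx K) (i j : int).

Lemma leading_polynomialE l' (F : {poly {poly K}}) roots tau alpha :
    F \is monic -> root_multiset l' F roots -> lies_on tau alpha ->
  ldeg (subst_pi l' F tau) = contacts tau.1 alpha roots /\
  exists2 c : K, c != 0 &
    f_ l' F tau = c *: \prod_(z <- branch tau.1 alpha roots) ('X - z%:P).
Proof.
move=> monF rF Ha; have [c c0 hF] := subst_pi_lead monF rF Ha.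
have lc0 : c *: \prod_(z <- branch tau.1 alpha roots) ('X - z%:P) != 0.
  by rewrite scaler_eq0 negb_or c0 monic_neq0 // monic_prod_XsubC.
have degE := has_lead_ldeg lc0 hF.
by split=> //; exists c => //; rewrite /f_ degE (proj1 hF).
Qed.

Lemma generic_zero l' rootsP' rootsQ' alpha i :
    (0 < l')%N -> root_multiset l' P rootsP' -> root_multiset l' Q rootsQ' ->
    alpha \in rootsP' -> contacts i alpha rootsP' = 0 ->
  uniq (branch i alpha rootsP') /\
  (forall z, z \in branch i alpha rootsP' -> z \notin branch i alpha rootsQ').
Proof.
move=> l'0 rP' rQ' aP c0; have [tau tau1 Ha] := lies_on_exists i alpha.
have [degP [c cn0 fP]] := leading_polynomialE monP rP' Ha.
have [_ [c' c'n0 fQ]] := leading_polynomialE monQ rQ' Ha.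
have [gen _ _] := genPQ.
have [||] := gen l' rootsP' tau l'0 rP'.
- apply/eqP => D0; have : alpha \in D rootsP' tau by rewrite mem_D aP; apply/asboolP.
  by rewrite D0.
- by rewrite /lambda degP tau1 c0 mul0r.
rewrite fP fQ tau1 => nm co; split; first exact: (mup_le1_uniq cn0 nm).
exact: (coprimep_disjoint cn0 c'n0 co).
Qed.

(** Let [p] be the degree in [t] at [i] and [d] the number of roots that agree above
    [i - 1].  If [p < d], the degree would vanish at the fractional order
    [i - p/d].  Passing to [l d] makes this order integral, and the leading
    polynomial there is the [d]-th power of [pi], with [d > 1]. *)
Lemma no_fractional_zero alpha i :
    alpha \in rootsP -> 0 < contacts i alpha rootsP ->
  0 <= contacts (i - 1) alpha rootsP.
Proof.
move=> aP p0; rewrite leNgt; apply/negP; rewrite contacts_pred.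
set p := contacts i alpha rootsP in p0 *; set d := size _ => ltpd.
have d0 : (0 < d)%N by lia.
have ls := contacts_stretch d0 i alpha rootsP p0 _.
have := @generic_zero (l * d) _ _ (lstretch d0 alpha) (i * d%:Z - p) _
  (root_multiset_stretch d0 monP rP) (root_multiset_stretch d0 monQ rQ).
case; rewrite ?muln_gt0 ?l_gt0 ?map_f //.
  by rewrite ls; [rewrite -/p -/d; ring|lia].
rewrite (@branch_stretch _ _ _ i) -/d; try nia.
move=> un _; have : (1 < d)%N by lia.
by move: un; case: (d) => [|[|e]] //=; rewrite inE eqxx.
Qed.

Variable c : K.
Hypothesis jacPQ : jac P Q = c%:P%:P.

(** The two cases correspond to a nonzero and a zero bracket constant. *)
Lemma leading_dichotomy alpha i :
  (uniq (branch i alpha rootsP) /\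
   forall z, z \in branch i alpha rootsP -> z \notin branch i alpha rootsQ) \/
  forall z, contacts i alpha rootsP * (count_mem z (branch i alpha rootsQ))%:Z =
            contacts i alpha rootsQ * (count_mem z (branch i alpha rootsP))%:Z.
Proof.
have [tau tau1 Ha] := lies_on_exists i alpha.
have [a a0 hP] := subst_pi_lead monP rP Ha.
have [b b0 hQ] := subst_pi_lead monQ rQ Ha.
rewrite tau1 in hP hQ.
have [k] := bracket_constant jacPQ Ha hP hQ.
have [->|k0] := eqVneq k 0; last first.
  move=> E; left; split.
    by apply: (mup_le1_uniq a0) => z; apply: (bracket_neq0_mup _ k0 E).
  by apply: (coprimep_disjoint a0 b0); apply: (bracket_neq0_coprime k0 E).
rewrite polyC0 => E; right=> z.
have := bracket_eq0_mup K_char0 z _ _ E; rewrite !mup_scale_prod //; apply.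
  by rewrite scaler_eq0 negb_or a0 monic_neq0 // monic_prod_XsubC.
by rewrite scaler_eq0 negb_or b0 monic_neq0 // monic_prod_XsubC.
Qed.

Variables (m n s : nat).
Hypotheses (m_gt1 : (1 < m)%N) (co_mn : coprime m n).
Hypotheses (s_gt0 : (0 < s)%N).
Hypotheses (szP : size rootsP = (m * s)%N) (szQ : size rootsQ = (n * s)%N).

Definition proportional alpha i : Prop :=
  n%:Z * contacts i alpha rootsP = m%:Z * contacts i alpha rootsQ /\
  (n * size (branch i alpha rootsP) = m * size (branch i alpha rootsQ))%N.

(** As [m] is prime to [n], it divides the number of agreeing roots of [P], which is
    positive because [alpha] is one of them. *)
Lemma proportional_size alpha i : alpha \in rootsP -> proportional alpha i ->
  (1 < size (branch i alpha rootsP))%N.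
Proof.
move=> aP [_ E]; have : (m %| n * size (branch i alpha rootsP))%N by rewrite E dvdn_mulr.
rewrite Gauss_dvdr // => /dvdn_leq; have := mem_branch i aP.
case: (branch _ _ _) => //= ? t _ /(_ isT) /(leq_trans m_gt1); exact.
Qed.

(** The multiplicities at [alpha_i] are the numbers of agreeing roots at [i - 1],
    and these are also the decrements of the two degrees. *)
Lemma proportional_pred alpha i :
    0 < contacts i alpha rootsP -> proportional alpha i ->
    (forall z, contacts i alpha rootsP * (count_mem z (branch i alpha rootsQ))%:Z =
               contacts i alpha rootsQ * (count_mem z (branch i alpha rootsP))%:Z) ->
  proportional alpha (i - 1).
Proof.
move=> p0 [E _] /(_ (lcoef alpha i)); rewrite -!size_branch_pred => Eb.
have Es : (n * size (branch (i - 1) alpha rootsP) =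
           m * size (branch (i - 1) alpha rootsQ))%N.
  move: Eb; set w := size _; set u := size _ => Eb.
  have : contacts i alpha rootsP * (n%:Z * u%:Z) = contacts i alpha rootsP * (m%:Z * w%:Z).
    by rewrite mulrA [_ * n%:Z]mulrC E -mulrA -Eb; ring.
  by move/(mulfI (lt0r_neq0 p0)); lia.
split=> //; rewrite !contacts_pred.
by move: E Es; set u := contacts _ _ _; set w := contacts _ _ _; lia.
Qed.

(** Distinct entries and size at least two make the pi-approximation of order [i] a
    final pi-root, which is major or minor by the sign condition.  That [P] and
    [Q] have no common entry keeps the roots of [Q] away from [alpha], and the
    ratio carries the vanishing of the degree from [P] to [Q]. *)
Definition splits alpha i : Prop :=
  [/\ 0 <= contacts i alpha rootsP,
      n%:Z * contacts i alpha rootsP = m%:Z * contacts i alpha rootsQ,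
      uniq (branch i alpha rootsP),
      forall z, z \in branch i alpha rootsP -> z \notin branch i alpha rootsQ &
      (1 < size (branch i alpha rootsP))%N].

(** The induction is on the degree of [P(tau)] in [t], which each step of the
    descent lowers by at least two. *)
Lemma splits_exists alpha : alpha \in rootsP -> exists i, splits alpha i.
Proof.
move=> aP.
suff H (N : nat) i : 0 < contacts i alpha rootsP -> contacts i alpha rootsP <= N%:Z ->
    proportional alpha i -> exists j, splits alpha j.
  (* Start at a positive order above which all the roots agree with [alpha]. *)
  have [i i0 ag] := agree_eventually alpha (rootsP ++ rootsQ).
  have [|cP bP] := @contacts_top _ i alpha rootsP.
    by move=> beta bP; apply: ag; rewrite mem_cat bP.
  have [|cQ bQ] := @contacts_top _ i alpha rootsQ.
    by move=> beta bQ; apply: ag; rewrite mem_cat bQ orbT.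
  apply: (H (absz (contacts i alpha rootsP)) i).
  - by rewrite cP szP; nia.
  - by lia.
  - by split; rewrite ?cP ?cQ ?bP ?bQ szP szQ; nia.
elim: N i => [|N IHN] i p0 pN pr; first by lia.
have [[ub db]|mults] := leading_dichotomy alpha i.
  exists i; split=> //; first exact: ltW.
    by case: pr.
  exact: proportional_size.
have pr1 := proportional_pred p0 pr mults.
have s1 := proportional_size aP pr1.
have := no_fractional_zero aP p0; rewrite le_eqVlt => /orP[/eqP z0|p1].
  have [ub db] := generic_zero l_gt0 rP rQ aP (esym z0).
  by exists (i - 1); split=> //; [rewrite -z0|case: pr1].
apply: IHN p1 _ pr1; rewrite contacts_pred.
by move: s1 pN; set u := size _; lia.
Qed.

End Descent.

(** * Resultants and roots *)

Section ResultantRoots.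
Variable R : comNzRingType.
Implicit Types (p q : {poly R}) (s : seq R).

Lemma det_castmx_sq n n' (e : n = n') (A : 'M[R]_n) :
  \det (castmx (e, e) A) = \det A.
Proof. by case: n' / e; rewrite castmx_id. Qed.

(** The two Sylvester matrices differ by the exchange of the two blocks of rows. *)
Lemma resultant_swap p q : exists b : bool, resultant q p = (-1) ^+ b * resultant p q.
Proof.
set M := (size q).-1; set N := (size p).-1.
pose e : (M + N = N + M)%N := addnC M N.
pose sw (x : 'I_N + 'I_M) : 'I_M + 'I_N :=
  match x with inl k => inr k | inr k => inl k end.
pose g (i : 'I_(N + M)) : 'I_(N + M) := cast_ord e (unsplit (sw (fintype.split i))).
have gI : injective g.
  move=> i j /cast_ord_inj /(can_inj unsplitK) E.
  apply: (can_inj fintype.splitK).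
  by move: E; case: (fintype.split i) => x; case: (fintype.split j) => y //= [->].
exists (perm gI : bool); rewrite /resultant -det_perm.
rewrite -(det_castmx_sq e (Sylvester_mx p q)) -det_mulmx -row_permE.
congr (\det _); apply/matrixP => i j.
rewrite [RHS]mxE castmxE permE /g /= cast_ordK.
rewrite Sylvester_mxE [RHS]Sylvester_mxE unsplitK.
by case: (fintype.split i).
Qed.

Lemma band_horner p a k n : (k + size p <= n)%N ->
  \sum_(r < n) (p`_(r - k) *+ (k <= r)%N) * a ^+ r = a ^+ k * p.[a].
Proof.
move=> le_n; rewrite mulrC -hornerXn -hornerM.
rewrite (horner_coef_wide _ (n := n)); last first.
  have [->|p0] := eqVneq p 0; first by rewrite mul0r size_poly0.
  by rewrite size_mulXn ?p0 // addnC.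
apply: eq_bigr => r _; rewrite coefMXn; congr (_ * _).
by case: ltnP => // _; rewrite mulr0n.
Qed.

(** Multiply the Sylvester matrix by the matrix of the map that sends a polynomial
    to its values at the entries of [s] and its top coefficients.  The multiples
    of the split polynomial have zero values, so the product is block triangular,
    with a unitriangular block of top coefficients; the values of the shifts of
    [q] form a Vandermonde matrix with scaled columns.  Keeping the Vandermonde
    factor on both sides makes the identity hold over any commutative ring. *)
Lemma Vandermonde_resultant s q :
  let V := \prod_(i < size s) \prod_(j < size s | (i < j)%N) (s`_j - s`_i) in
  V * resultant q (\prod_(a <- s) ('X - a%:P)) = V * \prod_(a <- s) q.[a].
Proof.
move=> V; set p := \prod_(a <- s) _.
have monp : p \is monic by apply: monic_prod_XsubC.
have szp : (size p).-1 = size s by rewrite size_prod_XsubC.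
have szp' : size p = (size p).-1.+1 by rewrite szp size_prod_XsubC.
have {V}-> : V = \det (Vandermonde (size p).-1 (\row_(j < (size p).-1) s`_j)).
  rewrite det_Vandermonde /V -szp; apply: eq_bigr => i _; apply: eq_bigr => j _.
  by rewrite !mxE.
have -> : \prod_(a <- s) q.[a] = \prod_(j < (size p).-1) q.[s`_j].
  by rewrite (big_nth 0) big_mkord szp.
set N := (size p).-1 in szp szp' *; set M := (size q).-1.
set a := \row_(j < N) _; set V := Vandermonde _ _.
have roota (j : 'I_N) : p.[s`_j] = 0.
  rewrite /p horner_prod (big_rem s`_j) ?mem_nth -?szp //=.
  by rewrite hornerXsubC subrr mul0r.
pose TL := \matrix_(i < N + M, j < N) s`_j ^+ i.
pose TR : 'M[R]_(N + M, M) := \matrix_(i, j) (i == rshift N j)%:R.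
have detT : \det (row_mx TL TR) = \det V.
  have -> : row_mx TL TR = block_mx V 0 (dsubmx TL) 1%:M.
    rewrite block_mxEh -[TL in LHS]vsubmxK -[TR in LHS]vsubmxK; congr row_mx.
      by congr col_mx; apply/matrixP => i j; rewrite !mxE.
    congr col_mx; apply/matrixP => i j; rewrite !mxE.
      by rewrite -val_eqE /= ltn_eqF // ltn_addr.
    by rewrite -val_eqE /= eqn_add2l.
  by rewrite det_lblock det1 mulr1.
rewrite -{1}detT mulrC /resultant -det_mulmx.
set S := Sylvester_mx q p.
have -> : S *m row_mx TL TR = col_mx (usubmx S) (dsubmx S) *m row_mx TL TR.
  by rewrite vsubmxK.
rewrite mul_col_row.
have SE := @Sylvester_mxE _ q p; rewrite -/S /= in SE.
have -> : dsubmx S *m TL = 0.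
  apply/matrixP => k j; rewrite [LHS]mxE [RHS]mxE.
  have k_le : (k + size p <= N + M)%N by rewrite szp' -addSnnS addnC leq_add2l.
  transitivity (s`_j ^+ k * p.[s`_j]); last by rewrite roota mulr0.
  rewrite -(band_horner _ k_le); apply: eq_bigr => r _; rewrite [TL _ _]mxE mxE SE.
  by rewrite -[rshift _ _]/(unsplit (inr k)) unsplitK.
have -> : usubmx S *m TL = V *m diag_mx (\row_j q.[s`_j]).
  apply/matrixP => k j; rewrite [LHS]mxE mul_mx_diag.
  transitivity (s`_j ^+ k * q.[s`_j]); last by rewrite !mxE.
  have k_le : (k + size q <= N + M)%N.
    by apply: leq_trans (leq_add (leqnn k) (leqSpred _)) _; rewrite -addSnnS leq_add2r.
  rewrite -(band_horner _ k_le).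
  apply: eq_bigr => r _; rewrite [TL _ _]mxE mxE SE.
  by rewrite -[lshift _ _]/(unsplit (inl k)) unsplitK.
rewrite det_ublock det_mulmx det_diag.
have -> : \det (dsubmx S *m TR) = 1.
  have UE k j : (dsubmx S *m TR) k j = p`_(N + j - k) *+ (k <= N + j)%N.
    rewrite [LHS]mxE (bigD1 (rshift N j)) //= big1 => [|r ner]; last first.
      by rewrite [TR _ _]mxE (negPf ner) mulr0.
    rewrite addr0 [TR _ _]mxE eqxx mulr1 mxE SE.
    by rewrite -[rshift _ k]/(unsplit (inr k)) unsplitK.
  rewrite det_trig; last first.
    apply/is_trig_mxP => k j ltkj; rewrite UE nth_default ?mul0rn // szp'.
    by rewrite -addnBA ?(ltnW ltkj) // -{1}[N]addn0 ltn_add2l subn_gt0.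
  rewrite big1 // => k _; rewrite UE leq_addl addnK.
  by have := monicP monp; rewrite /lead_coef -/N => ->.
by rewrite mulr1; under eq_bigr do rewrite mxE.
Qed.

End ResultantRoots.

(** * Separation orders and the degree of the resultant *)

Section Final.
Variables (K : fieldType).
Implicit Types (alpha beta : laurent K) (roots : seq (laurent K)) (i j : int).

Lemma size_branch_mono i j alpha roots : i <= j ->
  (size (branch i alpha roots) <= size (branch j alpha roots))%N.
Proof.
move=> leij; rewrite !size_map !size_filter; apply: sub_count => beta.
exact: agreeW.
Qed.

(** If [i < j], the roots that agree with [alpha] above [i] all have the coefficient
    of [alpha] at [j], so two of them make it a repeated entry of the branch at [j]. *)
Lemma split_order_uniq i j alpha roots :
    uniq (branch i alpha roots) -> (1 < size (branch i alpha roots))%N ->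
    uniq (branch j alpha roots) -> (1 < size (branch j alpha roots))%N ->
  i = j.
Proof.
have lt_absurd i' j' : uniq (branch j' alpha roots) ->
    (1 < size (branch i' alpha roots))%N -> i' < j' -> False.
  move=> uj si ltij; have : (size (branch i' alpha roots) <= 1)%N.
    apply: leq_trans (size_branch_mono alpha roots (_ : i' <= j' - 1)) _; first by lia.
    by rewrite size_branch_pred count_uniq_mem // leq_b1.
  by rewrite leqNgt si.
move=> ui si uj sj; have [ltij|ltji|//] := ltgtP i j.
  by case: (lt_absurd _ _ uj si ltij).
by case: (lt_absurd _ _ ui sj ltji).
Qed.

Lemma count_mem_branch i alpha roots :
  (count_mem alpha roots <= count_mem (lcoef alpha i) (branch i alpha roots))%N.
Proof.
rewrite count_map count_filter; apply: sub_count => beta /= /eqP ->.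
by rewrite eqxx agree_refl.
Qed.

(** Since no root in the list agrees with [alpha] above [i - 1], all the contacts at
    order [i] are degrees of differences with [alpha] itself. *)
Lemma value_lead i alpha roots :
    (forall beta, beta \in roots -> agree i alpha beta -> lcoef beta i != lcoef alpha i) ->
  exists2 c, c != 0 &
    has_lead (\prod_(beta <- roots) (alpha - beta)) (contacts i alpha roots) c.
Proof.
move=> sep.
have Nag beta : beta \in roots -> ~~ agree (i - 1) alpha beta.
  by move=> b_r; rewrite agree_pred; apply/andP => -[/(sep _ b_r) /negPf ->].
pose c beta := lcoef (alpha - beta) (ldeg (alpha - beta)).
exists (\prod_(beta <- roots) c beta).
  rewrite prodf_seq_neq0; apply/allP => beta /Nag /disagree_lead.
  by move=> [d d0 [_ [E _]]]; rewrite /c E.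
apply: has_lead_prod => beta /Nag Nab; rewrite agree_pred_contact (negPf Nab).
by have [d d0 [_ [_ H]]] := disagree_lead Nab; split.
Qed.

Lemma to_series_lead l (p : {poly K}) : (0 < l)%N -> p != 0 ->
  has_lead (to_series l p) (l%:Z * (size p).-1%:Z) (lead_coef p).
Proof.
move=> l_gt0 p0.
have E : to_series l p = \sum_(k < size p) lmon p`_k (l%:Z * k%:Z).
  rewrite /to_series /evalx -[in LHS](coefK p) poly_def rmorph_sum horner_sum.
  apply: eq_bigr => k _.
  rewrite -mul_polyC rmorphM /= map_polyC map_polyXn hornerM hornerC hornerXn /=.
  have -> : (lmon 1 l%:Z : laurent K) ^+ k = lmon 1 (l%:Z * k%:Z).
    elim: (nat_of_ord k) => [|k' IH]; first by rewrite mulr0.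
    by rewrite exprS IH lmonM mulr1; congr lmon; lia.
  by rewrite /lconst lmonM mulr1 add0r.
have szp : (0 < size p)%N by rewrite size_poly_gt0.
split=> [|j ltj]; rewrite E lcoef_sum.
  have lt : ((size p).-1 < size p)%N by rewrite ltn_predL.
  rewrite (bigD1 (Ordinal lt)) //= eqxx big1 ?addr0 // => k nek.
  rewrite ifF //; apply/negP => /eqP Ek; case/negP: nek; apply/eqP/val_inj => /=.
  by nia.
rewrite big1 // => k _; rewrite lcoef_mon ifF //.
by have := ltn_ord k; nia.
Qed.

(** The roots of [P] being distinct, the Vandermonde factor can be cancelled.  The
    sign comes from exchanging the two polynomials in the resultant. *)
Lemma to_series_resultant l (P Q : {poly {poly K}}) rootsP rootsQ :
    P \is monic -> Q \is monic -> uniq rootsP ->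
    root_multiset l P rootsP -> root_multiset l Q rootsQ ->
  exists b : bool, to_series l (resultant P Q) =
    (-1) ^+ b * \prod_(alpha <- rootsP) \prod_(beta <- rootsQ) (alpha - beta).
Proof.
move=> monP monQ uP /(root_multiset_monic _ _ monP) rP /(root_multiset_monic _ _ monQ) rQ.
have [b bE] := resultant_swap (map_poly (to_series l) Q) (map_poly (to_series l) P).
exists b; rewrite map_resultant /= ?(monicP monP) ?(monicP monQ) ?rmorph1 ?oner_neq0 //.
rewrite bE; congr (_ * _).
set V := \prod_(i < size rootsP) \prod_(j < size rootsP | (i < j)%N)
  (rootsP`_j - rootsP`_i).
have V0 : V <> 0.
  rewrite /V; elim/big_ind: _ => [|x y x0 y0 /laurent_integral[]//|i _].
    by move/eqP; rewrite oner_eq0.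
  elim/big_ind: _ => [|x y x0 y0 /laurent_integral[]//|j ltij].
    by move/eqP; rewrite oner_eq0.
  move=> /eqP; rewrite subr_eq0 nth_uniq // => /eqP ji.
  by rewrite ji ltnn in ltij.
have /eqP := Vandermonde_resultant rootsP (map_poly (to_series l) Q).
rewrite -/V -rP -subr_eq0 -mulrBr => /eqP/laurent_integral[//|/eqP].
rewrite subr_eq0 => /eqP ->; apply: eq_bigr => alpha _.
by rewrite rQ horner_prod; apply: eq_bigr => beta _; rewrite hornerXsubC.
Qed.

End Final.

(** * The sum over the major final pi-roots *)

Section FinalSum.
Variables (K : fieldType) (P Q : {poly {poly K}}) (l : nat).
Variables (rootsP rootsQ : seq (laurent K)) (m n : nat).
Hypotheses (l_gt0 : (0 < l)%N) (m_gt1 : (1 < m)%N) (monP : P \is monic) (monQ : Q \is monic).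
Hypotheses (rP : root_multiset l P rootsP) (rQ : root_multiset l Q rootsQ).
Implicit Types (alpha beta : laurent K) (tau : pi_approx K).

Local Notation splits := (splits rootsP rootsQ m n).
Local Notation cQ alpha tau := (contacts tau.1 alpha rootsQ).

Hypothesis splitting : forall alpha, alpha \in rootsP -> exists i, splits alpha i.

Lemma uniq_roots : uniq rootsP.
Proof.
apply: count_mem_uniq => alpha.
have [aP|aNP] := boolP (alpha \in rootsP); last by apply/count_memPn.
have [i [_ _ ub _ _]] := splitting aP.
apply/eqP; rewrite eqn_leq -has_count has_pred1 aP andbT.
by apply: leq_trans (count_mem_branch i alpha rootsP) _; rewrite count_uniq_mem // leq_b1.
Qed.

(** The leading polynomials of [P] and [Q] at the splitting order have no common
    root, so [value_lead] gives the degree of [Q] at each root of [P]. *)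
Lemma resultant_degree (order : laurent K -> int) :
    {in rootsP, forall alpha, splits alpha (order alpha)} ->
  l%:Z * (size (resultant P Q)).-1%:Z =
  \sum_(alpha <- rootsP) contacts (order alpha) alpha rootsQ.
Proof.
move=> ordP.
have [b bE] := to_series_resultant monP monQ uniq_roots rP rQ.
have val alpha : exists c, alpha \in rootsP -> c != 0 /\
    has_lead (\prod_(beta <- rootsQ) (alpha - beta)) (contacts (order alpha) alpha rootsQ) c.
  have [aP|_] := boolP (alpha \in rootsP); last by exists 0.
  have [_ _ _ disj _] := ordP _ aP.
  have [|c c0 hc] := @value_lead _ (order alpha) alpha rootsQ; last by exists c.
  move=> beta bQ ab; apply: contraNneq (disj _ (mem_branch (order alpha) aP)) => <-.
  by apply: map_f; rewrite mem_filter ab.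
have [c cP] := choice val.
have hprod : has_lead (\prod_(alpha <- rootsP) \prod_(beta <- rootsQ) (alpha - beta))
    (\sum_(alpha <- rootsP) contacts (order alpha) alpha rootsQ)
    (\prod_(alpha <- rootsP) c alpha).
  by apply: has_lead_prod => alpha /cP [].
have hsign : has_lead ((-1) ^+ b : laurent K) 0 ((-1) ^+ b).
  rewrite -[(-1) ^+ b : laurent K](rmorph_sign (@lconst K)); exact: has_lead_mon.
have := has_leadM hsign hprod; rewrite -bE add0r => hres.
have cn0 : (-1) ^+ b * \prod_(alpha <- rootsP) c alpha != 0.
  rewrite mulf_neq0 ?signr_eq0 // prodf_seq_neq0; apply/allP => alpha /cP[c0 _].
  by rewrite c0.
have res0 : resultant P Q != 0.
  apply: contraNneq cn0 => r0; case: hres => <- _.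
  by rewrite r0 rmorph0.
have lc0 : lead_coef (resultant P Q) != 0 by rewrite lead_coef_eq0.
by have [] := has_lead_uniq lc0 cn0 (to_series_lead l_gt0 res0) hres.
Qed.

Lemma lambdaE (F : {poly {poly K}}) roots tau alpha :
    F \is monic -> root_multiset l F roots -> lies_on tau alpha ->
  lambda l F tau = (contacts tau.1 alpha roots)%:~R / l%:R.
Proof. by move=> monF rF Ha; rewrite /lambda (proj1 (leading_polynomialE monF rF Ha)). Qed.

Lemma lambda_gt0 (F : {poly {poly K}}) roots tau alpha :
    F \is monic -> root_multiset l F roots -> lies_on tau alpha ->
  (0 < lambda l F tau) = (0 < contacts tau.1 alpha roots).
Proof.
by move=> monF rF Ha; rewrite (lambdaE monF rF Ha) pmulr_lgt0 ?ltr0z // invr_gt0 ltr0n.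
Qed.

Lemma final_pi_rootP tau alpha : alpha \in rootsP -> lies_on tau alpha ->
  final_pi_root l P rootsP tau <->
  uniq (branch tau.1 alpha rootsP) /\ (1 < size (branch tau.1 alpha rootsP))%N.
Proof.
move=> aP Ha; have [_ [c c0 fE]] := leading_polynomialE monP rP Ha.
have szf : (size (f_ l P tau)).-1 = size (branch tau.1 alpha rootsP).
  by rewrite fE size_scale // size_prod_XsubC.
rewrite /final_pi_root szf fE; split=> [[_ nm s1]|[ub s1]].
  by split=> //; apply: (mup_le1_uniq c0 nm).
split=> //.
  by apply/eqP => D0; have := mem_D tau alpha rootsP; rewrite D0 aP; case: asboolP.
by move=> z; rewrite mup_scale_prod // count_uniq_mem // leq_b1.
Qed.

(** Exchange the sums over [tau] and over the roots in [D tau].  A root whose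
    descent ends at positive degree lies in [D tau] for exactly one major [tau]; one
    whose descent ends at degree zero lies in none, and its value of [Q] has
    degree zero too. *)
Theorem sum_over_major_pi_roots :
  \sum_(tau \in major_pi_roots l P rootsP)
      (size (D rootsP tau))%:R * lambda l Q tau
  = ((size (resultant P Q)).-1)%:R :> rat.
Proof.
have exT alpha : exists tau, lies_on tau alpha /\
    (alpha \in rootsP -> splits alpha tau.1).
  have [/splitting [i si]|Na] := boolP (alpha \in rootsP).
    by have [tau tau1 Ha] := lies_on_exists i alpha; exists tau; rewrite tau1.
  by have [tau _ Ha] := lies_on_exists 0 alpha; exists tau.
have [tau_ tauP] := choice exT.
have tau_on alpha : lies_on (tau_ alpha) alpha by case: (tauP alpha).
have tau_split alpha : alpha \in rootsP -> splits alpha (tau_ alpha).1.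
  by case: (tauP alpha).
have final_uniq tau alpha : alpha \in rootsP -> lies_on tau alpha ->
    final_pi_root l P rootsP tau -> tau = tau_ alpha.
  move=> aP Ha /(final_pi_rootP aP Ha) [ub s1].
  have [_ _ ub' _ s1'] := tau_split _ aP.
  exact: (lies_on_inj Ha (tau_on alpha) (split_order_uniq ub s1 ub' s1')).
pose pos alpha := 0 < contacts (tau_ alpha).1 alpha rootsP.
(* Different roots may have the same final pi-root, hence the undup. *)
pose T := undup [seq tau_ alpha | alpha <- rootsP & pos alpha].
have major_on tau alpha : alpha \in rootsP -> lies_on tau alpha ->
    major_pi_roots l P rootsP tau <-> tau = tau_ alpha /\ pos alpha.
  move=> aP Ha; split=> [[fin lam]|[-> posa]].
    have E := final_uniq _ _ aP Ha fin; split=> //.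
    by rewrite /pos -E -(lambda_gt0 monP rP Ha).
  have [_ _ ub _ s1] := tau_split _ aP.
  split; first exact/(final_pi_rootP aP (tau_on alpha)).
  by rewrite (lambda_gt0 monP rP (tau_on alpha)).
have major_D tau : major_pi_roots l P rootsP tau ->
    exists2 alpha, alpha \in rootsP & lies_on tau alpha.
  move=> [[+ _ _] _]; rewrite /pi_root.
  case E: (D rootsP tau) => [//|alpha s] _.
  have : alpha \in D rootsP tau by rewrite E mem_head.
  by rewrite mem_D => /andP[aP /asboolP]; exists alpha.
have TE : major_pi_roots l P rootsP = [set` T].
  apply/seteqP; split=> tau /=; rewrite mem_undup.
    move=> maj; have [alpha aP Ha] := major_D _ maj.
    have [-> posa] := proj1 (major_on _ _ aP Ha) maj.
    by apply: map_f; rewrite mem_filter posa.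
  move=> /mapP [alpha]; rewrite mem_filter => /andP[posa aP] ->.
  exact/(major_on _ _ aP (tau_on alpha)).
rewrite TE -fsbig_seq ?undup_uniq //.
have {}TE tau : (tau \in T) = `[< major_pi_roots l P rootsP tau >].
  by apply/idP/asboolP; rewrite TE.
under eq_bigr => tau _.
  rewrite -sum1_size natr_sum mulr_suml big_filter big_mkcond /=; over.
rewrite exchange_big /=.
have termE alpha : alpha \in rootsP ->
    \sum_(tau <- T) (if `[< lies_on tau alpha >] then 1 * lambda l Q tau else 0) =
    (cQ alpha (tau_ alpha))%:~R / l%:R :> rat.
  move=> aP.
  have on_T tau : tau \in T -> lies_on tau alpha -> tau = tau_ alpha /\ pos alpha.
    by rewrite TE => /asboolP maj Ha; apply/(major_on _ _ aP Ha).
  have [posa|Npos] := boolP (pos alpha).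
    have tT : tau_ alpha \in T.
      by rewrite TE; apply/asboolP/(major_on _ _ aP (tau_on alpha)).
    rewrite (bigD1_seq (tau_ alpha)) ?undup_uniq //= asboolT //.
    rewrite mul1r (lambdaE monQ rQ (tau_on alpha)) big_seq_cond big1 ?addr0 //.
    move=> tau /andP[tau_T]; case: asboolP => // Ha.
    by have [-> _] := on_T _ tau_T Ha; rewrite eqxx.
  rewrite big_seq big1 => [|tau tau_T]; last first.
    case: asboolP => // Ha.
    by have [_ posa] := on_T _ tau_T Ha; rewrite posa in Npos.
  have [c0 prop _ _ _] := tau_split _ aP.
  suff -> : cQ alpha (tau_ alpha) = 0 by rewrite mul0r.
  move: Npos prop; rewrite /pos -leNgt; nia.
rewrite (eq_big_seq _ termE) -mulr_suml.
apply: (@mulIf _ l%:R); first by rewrite pnatr_eq0 -lt0n.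
rewrite divfK ?pnatr_eq0 -?lt0n //.
have -> : \sum_(alpha <- rootsP) (cQ alpha (tau_ alpha))%:~R =
    (\sum_(alpha <- rootsP) cQ alpha (tau_ alpha))%:~R :> rat.
  by rewrite rmorph_sum.
rewrite -(@resultant_degree (fun alpha => (tau_ alpha).1)) //.
by rewrite intrM -!pmulrn mulrC.
Qed.

End FinalSum.

Theorem theorem3p15 (K : closedFieldType) (K_char0 : [pchar K] =i pred0)
    (m n : nat) (m_gt1 : (1 < m)%N) (n_gt1 : (1 < n)%N) (co_mn : coprime m n)
    (P0 Q0 : {poly {poly K}})
    (minPQ : minimal_pair P0 Q0) (stdPQ : standard_pair m n P0 Q0)
    (a b : nat) (a_gt0 : (0 < a)%N) (lt_ab : (a < b)%N)
    (enP0 : en 1 0 P0 = (m * a, m * b)%N)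
    (enQ0 : en 1 0 Q0 = (n * a, n * b)%N)
    (leadP0 : lead 1 1 P0 = varx ^+ (a * m) * vary ^+ (b * m))
    (leadQ0 : lead 1 1 Q0 = varx ^+ (a * n) * vary ^+ (b * n))
    (P Q : {poly {poly K}}) (defP : P = psi P0) (defQ : Q = psi Q0)
    (genPQ : generic P Q)
    (l : nat) (l_gt0 : (0 < l)%N)
    (rootsP rootsQ : seq (laurent K))
    (rootsPE : root_multiset l P rootsP) (rootsQE : root_multiset l Q rootsQ) :
  \sum_(tau \in major_pi_roots l P rootsP)
      (size (D rootsP tau))%:R * lambda l Q tau
  = ((size (resultant P Q)).-1)%:R :> rat.
Proof.
have [monP szP] := psi_monic leadP0; have [monQ szQ] := psi_monic leadQ0.
rewrite -defP -mulnDl in monP szP; rewrite -defQ -mulnDl in monQ szQ.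
have [[jac0 _] _] := minPQ.
have [c c0 jacPQ] := psi_jac_unit jac0; rewrite -defP -defQ in jacPQ.
have size_roots (F : {poly {poly K}}) roots k : F \is monic ->
    root_multiset l F roots -> size F = k.+1 -> size roots = k.
  move=> monF /(root_multiset_monic _ _ monF) /(congr1 (fun p => size (polyseq p))).
  rewrite size_prod_XsubC size_map_poly_id0 => [-> [] //|].
  by rewrite (monicP monF) rmorph1 oner_neq0.
have sP := size_roots _ _ _ monP rootsPE szP; rewrite mulnC in sP.
have sQ := size_roots _ _ _ monQ rootsQE szQ; rewrite mulnC in sQ.
apply: (sum_over_major_pi_roots l_gt0 m_gt1 monP monQ rootsPE rootsQE (n := n)).
move=> alpha; apply: (splits_exists K_char0 l_gt0 monP monQ rootsPE rootsQE genPQ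
  jacPQ m_gt1 co_mn _ sP sQ).
by rewrite addn_gt0 a_gt0.
Qed.
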